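(* Let $K$ be a commutative ring with identity, $\delta\in K$, and let $\mathcal{B}(\delta)$ be the category of Brauer diagrams over $K$ with parameter $\delta$. Let $I$ be the unique $(1,1)$ Brauer diagram joining the lower node to the upper node, $X$ the $(2,2)$ diagram joining lower node $1$ to upper node $2$ and lower node $2$ to upper node $1$, $A$ the unique $(2,0)$ diagram, and $U$ the unique $(0,2)$ diagram. (1) The four diagrams $I,X,A,U$ generate all Brauer diagrams by composition $\circ$ and tensor product $\otimes$. These four diagrams are all fixed by ${}^\sharp$; moreover ${}^*$ fixes $I$ and $X$, while $A^*=U$ and $U^*=A$. (2) A complete set of relations among these four generators is given by the following relations and their transforms under ${}^*$ and ${}^\sharp$: $$I\circ I=I,\quad (I\otimes I)\circ X=X,\quad A\circ(I\otimes I)=A,\quad (I\otimes I)\circ U=U,$$ $$X\circ X=I\otimes I,$$ $$(X\otimes I)\circ(I\otimes X)\circ(X\otimes I)=(I\otimes X)\circ(X\otimes I)\circ(I\otimes X),$$ $$A\circ X=A,$$ $$A\circ U=\delta,$$ $$(A\otimes I)\circ(I\otimes X)=(I\otimes A)\circ(X\otimes I),$$ $$(A\otimes I)\circ(I\otimes U)=I.$$ That is, any equation in $\mathcal{B}(\delta)$ relating two words in the generators $I,X,A,U$ (formed using $\circ$ and $\otimes$) can be deduced from these relations and their transforms, together with the general properties of $\circ$ and $\otimes$.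
   Context: For $k,\ell\in\mathbb{N}=\{0,1,2,\dots\}$, a $(k,\ell)$ Brauer diagram is a partition into pairs (arcs) of a set of $k+\ell$ nodes, $k$ of them placed on a lower horizontal line and $\ell$ on a parallel upper line, each row numbered from left to right; only the pairing matters. There is exactly one $(0,0)$ diagram, the empty one. $B_k^\ell(\delta)$ is the free $K$-module with basis the $(k,\ell)$ Brauer diagrams (so it is $0$ if $k+\ell$ is odd, and $B_0^0(\delta)=K$). Composition $\circ: B_\ell^p(\delta)\times B_k^\ell(\delta)\to B_k^p(\delta)$ is the $K$-bilinear map with $D_1\circ D_2=\delta^{f}D$, where $D_1$ is placed above $D_2$, the lower nodes of $D_1$ are identified with the upper nodes of $D_2$, $f$ is the number of closed loops so formed, and $D$ is the $(k,p)$ diagram remaining after deleting them. Tensor product $\otimes: B_p^q(\delta)\times B_k^\ell(\delta)\to B_{p+k}^{q+\ell}(\delta)$ is the $K$-bilinear map given by juxtaposition, $D\otimes D'$ having $D'$ to the right of $D$. The category $\mathcal{B}(\delta)$ has objects $\mathbb{N}$, $\mathrm{Hom}(k,\ell)=B_k^\ell(\delta)$, composition $\circ$, and tensor product $k\otimes \ell=k+\ell$ on objects and $\otimes$ on morphisms. The duality $D\mapsto D^*$ ($B_k^\ell\to B_\ell^k$) is reflection of a diagram in a horizontal line; it satisfies $(D_1\circ D_2)^*=D_2^*\circ D_1^*$, $(D_1\otimes D_2)^*=D_1^*\otimes D_2^*$. The involution $D\mapsto D^\sharp$ ($B_k^\ell\to B_k^\ell$) is reflection in a vertical line; it satisfies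 $(D_1\circ D_2)^\sharp=D_1^\sharp\circ D_2^\sharp$, $(D_1\otimes D_2)^\sharp=D_2^\sharp\otimes D_1^\sharp$. The ''general properties of $\circ$ and $\otimes$'' are associativity, $K$-bilinearity, the empty diagram being a unit for $\otimes$, and the interchange law $(D_1\otimes D_2)\circ(D_1'\otimes D_2')=(D_1\circ D_1')\otimes(D_2\circ D_2')$ for composable diagrams. A word in the generators equals in general $\delta^N D$ with $D$ a diagram and $N\geq 0$.
   Formalization: To the general properties of ∘ and ⊗ is added that the empty diagram is the identity of object 0 for ∘ (without it I∘(I⊗A)=I⊗A cannot be deduced); the empty diagram also counts as a word. *)

(* Defs.v *)
From mathcomp Require Import all_boot all_order all_fingroup all_algebra.

Set Implicit Arguments.
Unset Strict Implicit.
Unset Printing Implicit Defensive.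

Import GRing.Theory.
Local Open Scope nat_scope.

Definition is_pairing (T : finType) (P : {set {set T}}) : bool :=
  partition P [set: T] && [forall B in P, #|B| == 2].

Section PairingTheory.

Variables (T : finType) (P : {set {set T}}).
Hypothesis pairP : is_pairing P.

Let partP : partition P [set: T]. Proof. by case/andP: pairP. Qed.
Let covP : cover P = [set: T]. Proof. exact: cover_partition partP. Qed.
Let tiP : trivIset P. Proof. exact: partition_trivIset partP. Qed.

Let inP x : x \in cover P. Proof. by rewrite covP inE. Qed.

Lemma pairing_card (B : {set T}) : B \in P -> #|B| = 2.
Proof. by case/andP: pairP => _ /forall_inP h /h /eqP. Qed.

Definition mate (x : T) : T := odflt x [pick y in pblock P x | y != x].

Lemma mate_spec x : mate x != x /\ pblock P x = [set x; mate x].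
Proof.
have Bx : pblock P x \in P by rewrite pblock_mem.
have xB : x \in pblock P x by rewrite mem_pblock.
rewrite /mate; case: pickP => [y /andP[yB yx]|no] /=.
  split=> //; apply/eqP; rewrite eq_sym eqEcard (pairing_card Bx).
  rewrite cards2 eq_sym yx andbT; apply/subsetP => z.
  by rewrite !inE => /orP[] /eqP ->.
have /cards2P[a [b [ab EB]]] : #|pblock P x| == 2 by rewrite (pairing_card Bx).
have := no a; have := no b; rewrite EB !inE !eqxx orbT /=.
by move=> /negbFE/eqP bx /negbFE/eqP ax; rewrite ax bx eqxx in ab.
Qed.

Lemma mate_neq x : mate x != x. Proof. by case: (mate_spec x). Qed.

Lemma mateE x y : (y \in pblock P x) = (y == x) || (y == mate x).
Proof. by case: (mate_spec x) => _ ->; rewrite !inE. Qed.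

Lemma mateK : involutive mate.
Proof.
move=> x; have xm : mate x \in pblock P x by rewrite mateE eqxx orbT.
have E := same_pblock tiP xm.
have : x \in pblock P (mate x) by rewrite E mem_pblock.
by rewrite mateE eq_sym (negPf (mate_neq x)) => /eqP.
Qed.

Lemma pairing_block B x y :
  B \in P -> x \in B -> y \in B -> (y == x) || (y == mate x).
Proof. by move=> BP xB yB; rewrite -mateE (def_pblock tiP BP xB). Qed.

Lemma mate_block x : exists2 B, B \in P & (x \in B) && (mate x \in B).
Proof.
exists (pblock P x); first by rewrite pblock_mem.
by rewrite mem_pblock inP mateE eqxx orbT.
Qed.

End PairingTheory.

Lemma setT_pairing (T : finType) : #|T| = 2 -> is_pairing [set [set: T]].
Proof.
move=> cT; apply/andP; split.
  rewrite /partition /cover big_set1 eqxx trivIset1 inE /=.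
  by rewrite eq_sym -card_gt0 cardsT cT.
by apply/forall_inP => B; rewrite inE => /eqP ->; rewrite cardsT cT.
Qed.

Lemma imset_pairing (T T' : finType) (f : T -> T') (P : {set {set T}}) :
  bijective f -> is_pairing P ->
  is_pairing [set f @: B | B : {set T} in P].
Proof.
move=> bf /andP[pP /forall_inP cP]; have fI := bij_inj bf.
apply/andP; split.
  have <- : [set f x | x in [set: T]] = [set: T'].
    case: bf => g fK gK; apply/setP => y; rewrite !inE; apply/imsetP.
    by exists (g y); rewrite ?inE ?gK.
  by rewrite imset_partition.
by apply/forall_inP => _ /imsetP[B BP ->]; rewrite card_imset // cP.
Qed.

Lemma union_pairing (T1 T2 T : finType) (f : T1 -> T) (g : T2 -> T)
    (P : {set {set T1}}) (Q : {set {set T2}}) :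
  injective f -> injective g -> (forall x y, f x != g y) ->
  (forall z, (exists x, z = f x) \/ (exists y, z = g y)) ->
  is_pairing P -> is_pairing Q ->
  is_pairing ([set f @: B | B : {set T1} in P] :|:
              [set g @: B | B : {set T2} in Q]).
Proof.
move=> fI gI fg fgT /andP[pP /forall_inP cP] /andP[pQ /forall_inP cQ].
apply/andP; split; last first.
  apply/forall_inP => _ /setUP[] /imsetP[B BP ->]; rewrite card_imset //.
    exact: cP.
  exact: cQ.
have pP' : partition [set f @: B | B : {set T1} in P] (f @: [set: T1]).
  by rewrite imset_partition.
have pQ' : partition [set g @: B | B : {set T2} in Q] (g @: [set: T2]).
  by rewrite imset_partition.
have dis : [disjoint f @: [set: T1] & g @: [set: T2]].
  apply/pred0P => z /=; apply/negP => /andP[/imsetP[x _ ->]].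
  by case/imsetP => y _ /eqP; rewrite (negPf (fg x y)).
apply/and3P; split.
- rewrite /cover bigcup_setU -/(cover _) -/(cover _).
  rewrite (cover_partition pP') (cover_partition pQ').
  apply/eqP/setP => z; rewrite !inE; apply/orP.
  by case: (fgT z) => -[x ->]; [left | right]; rewrite imset_f ?inE.
- apply: trivIsetU (partition_trivIset pP') (partition_trivIset pQ') _.
  by rewrite (cover_partition pP') (cover_partition pQ').
- by rewrite inE (partition0 pP') (partition0 pQ').
Qed.

(** Lower nodes are on the left of the sum, upper nodes on the right; node
    number [i + 1] of a row is the ordinal [i]. *)
Definition node (k l : nat) : finType := ('I_k + 'I_l)%type.

Definition brauer (k l : nat) : Type :=
  {P : {set {set node k l}} | is_pairing P}.

Definition arcs k l (D : brauer k l) : {set {set node k l}} := val D.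

Lemma arcs_pairing k l (D : brauer k l) : is_pairing (arcs D).
Proof. exact: valP. Qed.

(** The nodes of [D1] placed above [D2]: lower and middle nodes on the left,
    upper nodes on the right. *)
Definition glued (k l p : nat) : finType := (node k l + 'I_p)%type.

Definition from_below k l p (x : node k l) : glued k l p := inl x.

Definition from_above k l p (x : node l p) : glued k l p :=
  match x with inl j => inl (inr j) | inr u => inr u end.

Definition from_outer k l p (x : node k p) : glued k l p :=
  match x with inl i => inl (inl i) | inr u => inr u end.

Definition linked k l p (D1 : brauer l p) (D2 : brauer k l) :
    rel (glued k l p) := fun x y =>
  [exists B in arcs D2,
     (x \in @from_below k l p @: B) && (y \in @from_below k l p @: B)]
  || [exists B in arcs D1,
     (x \in @from_above k l p @: B) && (y \in @from_above k l p @: B)].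

Definition comp_arcs k l p (D1 : brauer l p) (D2 : brauer k l) :
    {set {set node k p}} :=
  equivalence_partition
    (fun x y => connect (linked D1 D2) (from_outer l x) (from_outer l y))
    [set: node k p].

(** The closed loops are the connected components of the glued picture that
    contain no outer node. *)
Definition loops k l p (D1 : brauer l p) (D2 : brauer k l) : nat :=
  #|[set C in equivalence_partition (connect (linked D1 D2))
                [set: glued k l p] |
     [forall x : node k p, from_outer l x \notin C]]|.

(** Used to prove that [comp_arcs] is a pairing: in the orbit of a fixed point
    of an involution [t] under the group generated by [t] and a
    fixed-point-free involution [s], there is exactly one other fixed point
    of [t]. *)
Section DihedralOrbit.

Variables (V : finType) (s t : V -> V).
Hypotheses (sK : involutive s) (tK : involutive t).
Hypothesis s_neq : forall v, s v != v.

Let ts_inj : injective (t \o s).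
Proof. by apply: inj_comp; apply: inv_inj. Qed.

Let c : {perm V} := perm ts_inj.

Let cE v : c v = t (s v). Proof. by rewrite permE. Qed.

Let s_c v : s (c v) = (c^-1)%g (s v).
Proof. by apply: (@perm_inj _ c); rewrite permKV !cE sK. Qed.

Let t_c v : t (c v) = (c^-1)%g (t v).
Proof. by apply: (@perm_inj _ c); rewrite permKV !cE tK sK. Qed.

Variable x : V.
Hypothesis tx : t x = x.

Let t_cX i : t ((c ^+ i)%g x) = (c ^- i)%g x.
Proof.
elim: i => [|i IH]; first by rewrite expg0 invg1 perm1.
by rewrite expgSr permM t_c IH -permM -invMg -expgS expgSr.
Qed.

Let s_cX i : s ((c ^+ i)%g x) = (c ^- i.+1)%g x.
Proof.
elim: i => [|i IH].
  by rewrite expg0 perm1 expg1; apply: (@perm_inj _ c); rewrite permKV cE sK.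
by rewrite expgSr permM s_c IH -permM -invMg -expgS.
Qed.

Definition dihedral_orbit : {set V} := porbit c x.

Lemma dihedral_orbit_refl : x \in dihedral_orbit.
Proof. exact: porbit_id. Qed.

Lemma dihedral_orbit_t v : v \in dihedral_orbit -> t v \in dihedral_orbit.
Proof.
case/porbitP => i ->; rewrite t_cX /dihedral_orbit porbit_sym.
by apply/porbitP; exists i; rewrite permKV.
Qed.

Lemma dihedral_orbit_s v : v \in dihedral_orbit -> s v \in dihedral_orbit.
Proof.
case/porbitP => i ->; rewrite s_cX /dihedral_orbit porbit_sym.
by apply/porbitP; exists i.+1; rewrite permKV.
Qed.

Lemma dihedral_orbit_ind (Q : V -> Prop) :
  Q x -> (forall v, Q v -> Q (s v)) -> (forall v, Q v -> Q (t v)) ->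
  forall v, v \in dihedral_orbit -> Q v.
Proof.
move=> Qx Qs Qt v /porbitP[i ->]; elim: i => [|i IH].
  by rewrite expg0 perm1.
by rewrite expgSr permM cE; apply/Qt/Qs.
Qed.

Lemma dihedral_orbit_fixed :
  exists y, [/\ y != x, t y = y, y \in dihedral_orbit &
    forall v, v \in dihedral_orbit -> t v = v -> v = x \/ v = y].
Proof.
pose N := #|porbit c x|.
have N_gt0 : 0 < N by apply/card_gt0P; exists x; apply: porbit_id.
have cN : (c ^+ N)%g x = x by rewrite permX iter_porbit.
have cXN a : (c ^+ (a * N))%g x = x.
  elim: a => [|a IH]; first by rewrite mul0n expg0 perm1.
  by rewrite mulSn expgD permM cN IH.
have c_inj a b : a < N -> b < N -> (c ^+ a)%g x = (c ^+ b)%g x -> a = b.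
  move=> aN bN; have U := uniq_traject_porbit c x.
  rewrite !permX => E; apply/eqP.
  rewrite -(nth_uniq x _ _ U) ?size_traject //.
  by rewrite !nth_traject // E.
have c_mod a : (c ^+ a)%g x = (c ^+ (a %% N))%g x.
  by rewrite {1}(divn_eq a N) expgD permM cXN.
have sym a b : (c ^- a)%g x = (c ^+ b)%g x -> N %| a + b.
  move=> E; have : (c ^+ (a + b))%g x = x.
    by rewrite addnC expgD permM -E -permM mulVg perm1.
  rewrite c_mod -[RHS](_ : (c ^+ 0)%g x = x); last by rewrite expg0 perm1.
  by move=> E0; apply/eqP; apply: (c_inj _ 0) => //; rewrite ltn_mod.
have evN : ~~ odd N.
  apply/negP => oN; have := s_neq ((c ^+ (N./2))%g x); rewrite s_cX.
  case/eqP; apply: (@perm_inj _ (c ^+ (N./2).+1)%g).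
  rewrite -permM mulVg perm1 -permM -expgD addnS addnn.
  by have := odd_double_half N; rewrite oN add1n => ->; rewrite cN.
have hN : N = (N./2).*2 by have := odd_double_half N; rewrite (negPf evN).
have h_gt0 : 0 < N./2 by rewrite -double_gt0 -hN.
have h_lt : N./2 < N by rewrite [X in _ < X]hN -addnn -[X in X < _]addn0 ltn_add2l.
exists ((c ^+ (N./2))%g x); split.
- apply/eqP => E; have : N./2 = 0.
    by apply: c_inj => //; rewrite E expg0 perm1.
  by move=> E0; rewrite E0 in h_gt0.
- rewrite t_cX; apply: (@perm_inj _ (c ^+ N./2)%g).
  by rewrite -permM mulVg perm1 -permM -expgD addnn -hN cN.
- by apply/porbitP; exists N./2.
- move=> _ /porbitP[i ->]; rewrite (c_mod i); set a := i %% N.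
  have aN : a < N by rewrite ltn_mod.
  rewrite t_cX => /sym; rewrite addnn => /dvdnP[q Eq].
  have Ea : a = q * N./2 by apply: double_inj; rewrite Eq [in LHS]hN doubleMr.
  case: q {Eq} Ea => [|[|q]] Ea.
  + by left; rewrite Ea mul0n expg0 perm1.
  + by right; rewrite Ea mul1n.
  + by move: aN; rewrite Ea [X in _ < X]hN -mul2n ltn_pmul2r.
Qed.

End DihedralOrbit.

Section CompPairing.

Variables (k l p : nat) (D1 : brauer l p) (D2 : brauer k l).

Let P1 := arcs_pairing D1.
Let P2 := arcs_pairing D2.
Let e := linked D1 D2.
Let V : finType := (node k l + node l p)%type.

Let s (v : V) : V :=
  match v with
  | inl a => inl (mate (arcs D2) a)
  | inr b => inr (mate (arcs D1) b)
  end.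

Let t (v : V) : V :=
  match v with
  | inl (inr j) => inr (inl j)
  | inr (inl j) => inl (inr j)
  | _ => v
  end.

Let pi (v : V) : glued k l p :=
  match v with
  | inl a => from_below p a
  | inr b => from_above k b
  end.

Let lift (x : node k p) : V :=
  match x with inl i => inl (inl i) | inr u => inr (inr u) end.

Let sK : involutive s.
Proof. by case=> a /=; rewrite mateK. Qed.

Let tK : involutive t. Proof. by case=> [[]|[]]. Qed.

Let s_neq v : s v != v.
Proof. by case: v => a; apply/eqP => -[] /eqP; apply/negP/mate_neq. Qed.

Let t_lift x : t (lift x) = lift x. Proof. by case: x. Qed.

Let pi_lift x : pi (lift x) = from_outer l x. Proof. by case: x. Qed.

Let lift_inj : injective lift.
Proof. by case=> x [] y // [->]. Qed.

Let fixed_lift v : t v = v -> exists x, v = lift x.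
Proof. by case: v => [[i|]|[|u]] //= _; [exists (inl i) | exists (inr u)]. Qed.

Let pi_eq v w : pi v = pi w -> w = v \/ w = t v.
Proof.
by case: v => [[i|j]|[j|u]]; case: w => [[i'|j']|[j'|u']] //= [->];
  first [by left | by right].
Qed.

Let linked_sym : symmetric e.
Proof.
move=> x y; rewrite /e /linked.
by congr (_ || _); apply: eq_existsb => B; congr (_ && _); rewrite andbC.
Qed.

Let csym : connect_sym e. Proof. exact: sym_connect_sym. Qed.

Let linked_s v : e (pi v) (pi (s v)).
Proof.
apply/orP; case: v => a; [left | right].
  have [B BD /andP[aB mB]] := mate_block P2 a.
  by apply/exists_inP; exists B => //; apply/andP; split; apply: imset_f.
have [B BD /andP[aB mB]] := mate_block P1 a.
by apply/exists_inP; exists B => //; apply/andP; split; apply: imset_f.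
Qed.

Let linked_pi v z : e (pi v) z ->
  [\/ z = pi v, z = pi (s v) | z = pi (s (t v))].
Proof.
case/orP => /exists_inP[B BD /andP[/imsetP[a aB Ea] /imsetP[b bB ->]]].
  have Ev : pi (inl a) = pi v by rewrite Ea.
  case/orP: (pairing_block P2 BD aB bB) => /eqP ->; first by rewrite Ea; constructor 1.
  have Em : from_below p (mate (arcs D2) a) = pi (s (inl a)) by [].
  rewrite Em; case: (pi_eq Ev) => ->; first by constructor 2.
  by rewrite tK; constructor 3.
have Ev : pi (inr a) = pi v by rewrite Ea.
case/orP: (pairing_block P1 BD aB bB) => /eqP ->; first by rewrite Ea; constructor 1.
have Em : from_above k (mate (arcs D1) a) = pi (s (inr a)) by [].
rewrite Em; case: (pi_eq Ev) => ->; first by constructor 2.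
by rewrite tK; constructor 3.
Qed.

Let pi_t v : pi (t v) = pi v. Proof. by case: v => [[]|[]]. Qed.

Let connect_orbit x y :
  connect e (from_outer l x) (from_outer l y) =
  (lift y \in dihedral_orbit sK tK (lift x)).
Proof.
set O := dihedral_orbit sK tK (lift x).
have Ot := dihedral_orbit_t (t_lift x); have Os := dihedral_orbit_s (t_lift x).
apply/idP/idP.
  case/connectP => q; rewrite -!pi_lift => pq Eq.
  suff [v vO Ev] : exists2 v, v \in O & last (pi (lift x)) q = pi v.
    by case: (pi_eq (etrans (esym Ev) (esym Eq))) => ->; rewrite // Ot.
  elim/last_ind: q pq {Eq} => [|q z IH].
    by exists (lift x) => //; apply: dihedral_orbit_refl.
  rewrite rcons_path last_rcons => /andP[/IH[v vO ->]] /linked_pi[] ->.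
  - by exists v.
  - by exists (s v) => //; apply: Os.
  - by exists (s (t v)) => //; apply/Os/Ot.
move=> yO; rewrite -!pi_lift.
pose Q v := connect e (pi (lift x)) (pi v).
apply: (dihedral_orbit_ind (Q := Q) _ _ _ yO) => [|v IH|v IH]; rewrite /Q.
- exact: connect0.
- exact: connect_trans IH (connect1 (linked_s v)).
- by rewrite pi_t.
Qed.

Lemma comp_arcs_pairing : is_pairing (comp_arcs D1 D2).
Proof.
have eqR : {in [set: node k p] & &, equivalence_rel (fun x y =>
    connect e (from_outer l x) (from_outer l y))}.
  move=> x y z _ _ _; split; first exact: connect0.
  by move/(same_connect csym) => ->.
apply/andP; split; first exact: equivalence_partitionP eqR.
apply/forall_inP => _ /imsetP[x _ ->].
have [v [vx tv vin vO]] := dihedral_orbit_fixed sK tK s_neq (t_lift x).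
have [y Ey] := fixed_lift tv; rewrite Ey in vx vin vO.
suff -> : [set z in [set: node k p] |
    connect e (from_outer l x) (from_outer l z)] = [set x; y].
  have xy : x != y by rewrite eq_sym -(inj_eq lift_inj).
  by rewrite cards2 xy.
apply/setP => z; rewrite !inE connect_orbit; apply/idP/orP.
  by move/vO => /(_ (t_lift z))[] /lift_inj ->; [left | right].
by case=> /eqP -> //; apply: dihedral_orbit_refl.
Qed.

End CompPairing.

Definition dcomp k l p (D1 : brauer l p) (D2 : brauer k l) : brauer k p :=
  Sub (comp_arcs D1 D2) (comp_arcs_pairing D1 D2).

Definition left_node p q k l (x : node p q) : node (p + k) (q + l) :=
  match x with inl i => inl (lshift k i) | inr u => inr (lshift l u) end.

Definition right_node p q k l (x : node k l) : node (p + k) (q + l) :=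
  match x with inl i => inl (rshift p i) | inr u => inr (rshift q u) end.

Definition tens_arcs p q k l (D : brauer p q) (D' : brauer k l) :
    {set {set node (p + k) (q + l)}} :=
  [set @left_node p q k l @: B | B : {set node p q} in arcs D] :|:
  [set @right_node p q k l @: B | B : {set node k l} in arcs D'].

Lemma tens_arcs_pairing p q k l (D : brauer p q) (D' : brauer k l) :
  is_pairing (tens_arcs D D').
Proof.
apply: union_pairing (arcs_pairing D) (arcs_pairing D').
- by case=> x [] y //= [/val_inj ->].
- by case=> x [] y //= [/addnI/val_inj ->].
- by case=> x [] y //=; apply/eqP => -[E]; have := ltn_ord x;
    rewrite E ltnNge leq_addr.
- case=> z; rewrite -(splitK z); case: (split z) => i /=.
  + by left; exists (inl i).
  + by right; exists (inl i).
  + by left; exists (inr i).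
  + by right; exists (inr i).
Qed.

Definition dtens p q k l (D : brauer p q) (D' : brauer k l) :
    brauer (p + k) (q + l) :=
  Sub (tens_arcs D D') (tens_arcs_pairing D D').

Definition flip_node k l (x : node k l) : node l k :=
  match x with inl i => inr i | inr u => inl u end.

Definition mirror_node k l (x : node k l) : node k l :=
  match x with inl i => inl (rev_ord i) | inr u => inr (rev_ord u) end.

Lemma flip_node_bij k l : bijective (@flip_node k l).
Proof. by exists (@flip_node l k); case. Qed.

Lemma mirror_node_bij k l : bijective (@mirror_node k l).
Proof. by exists (@mirror_node k l); case=> i /=; rewrite rev_ordK. Qed.

Definition dstar k l (D : brauer k l) : brauer l k :=
  Sub [set @flip_node k l @: B | B : {set node k l} in arcs D]
      (imset_pairing (@flip_node_bij k l) (arcs_pairing D)).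

Definition dsharp k l (D : brauer k l) : brauer k l :=
  Sub [set @mirror_node k l @: B | B : {set node k l} in arcs D]
      (imset_pairing (@mirror_node_bij k l) (arcs_pairing D)).

Lemma card_node k l : #|node k l| = k + l.
Proof. by rewrite card_sum !card_ord. Qed.

(** On two nodes there is only one pairing. *)
Definition diagI : brauer 1 1 := Sub [set setT] (setT_pairing (card_node 1 1)).
Definition diagA : brauer 2 0 := Sub [set setT] (setT_pairing (card_node 2 0)).
Definition diagU : brauer 0 2 := Sub [set setT] (setT_pairing (card_node 0 2)).

Definition cross_arcs : {set {set node 2 2}} :=
  [set [set inl ord0; inr ord_max]; [set inl ord_max; inr ord0]].

Lemma cross_arcs_pairing : is_pairing cross_arcs.
Proof.
apply/andP; split; last first.
  by apply/forall_inP => B /set2P[] ->; rewrite cards2.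
apply/and3P; split.
- apply/eqP/setP => z; rewrite /cross_arcs /cover bigcup_setU !big_set1 !inE.
  by case: z => -[[|[|m]] h].
- apply/trivIsetP => B C /set2P[] -> /set2P[] ->; rewrite ?eqxx // => _;
    by apply/pred0P => z; rewrite /= !inE; case: z => -[[|[|m]] h].
- by apply/negP => /set2P[] /esym/eqP; apply/negP/set0Pn;
    [exists (inl ord0) | exists (inl ord_max)]; rewrite !inE eqxx.
Qed.

Definition diagX : brauer 2 2 := Sub cross_arcs cross_arcs_pairing.

Lemma empty_pairing : is_pairing (set0 : {set {set node 0 0}}).
Proof.
apply/andP; split; last by apply/forall_inP => B; rewrite inE.
have -> : [set: node 0 0] = set0 by apply/setP => -[[]|[]].
by rewrite partition_set0.
Qed.

Definition diag0 : brauer 0 0 := Sub set0 empty_pairing.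

Section BrauerCategory.

Variables (K : comPzRingType) (delta : K).
Local Open Scope ring_scope.

Local Notation bhom k l := {ffun brauer k l -> K^o}.

Definition basis k l (D : brauer k l) : bhom k l :=
  [ffun D' => (D' == D)%:R].

Definition bcomp k l p (f : bhom l p) (g : bhom k l) : bhom k p :=
  \sum_(D1 : brauer l p) \sum_(D2 : brauer k l)
    (f D1 * g D2) *: (delta ^+ loops D1 D2 *: basis (dcomp D1 D2)).

Definition btens p q k l (f : bhom p q) (g : bhom k l) :
    bhom (p + k)%N (q + l)%N :=
  \sum_(D : brauer p q) \sum_(D' : brauer k l)
    (f D * g D') *: basis (dtens D D').

(** The expressions are typed by their numbers of lower and upper nodes. *)
Inductive expr : nat -> nat -> Type :=
| Empty : expr 0 0
| GenI : expr 1 1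
| GenX : expr 2 2
| GenA : expr 2 0
| GenU : expr 0 2
| Comp k l p of expr l p & expr k l : expr k p
| Tens p q k l of expr p q & expr k l : expr (p + k)%N (q + l)%N
| Zero k l : expr k l
| Add k l of expr k l & expr k l : expr k l
| Scale k l of K & expr k l : expr k l.

Arguments Zero {k l}.

Fixpoint is_word k l (a : expr k l) : bool :=
  match a with
  | Empty | GenI | GenX | GenA | GenU => true
  | Comp _ _ _ a b => is_word a && is_word b
  | Tens _ _ _ _ a b => is_word a && is_word b
  | Zero _ _ | Add _ _ _ _ | Scale _ _ _ _ => false
  end.

Fixpoint eval k l (a : expr k l) : bhom k l :=
  match a in expr k l return bhom k l with
  | Empty => basis diag0
  | GenI => basis diagI
  | GenX => basis diagX
  | GenA => basis diagA
  | GenU => basis diagU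
  | Comp _ _ _ a b => bcomp (eval a) (eval b)
  | Tens _ _ _ _ a b => btens (eval a) (eval b)
  | Zero _ _ => 0
  | Add _ _ a b => eval a + eval b
  | Scale _ _ c a => c *: eval a
  end.

Fixpoint star k l (a : expr k l) : expr l k :=
  match a in expr k l return expr l k with
  | Empty => Empty
  | GenI => GenI
  | GenX => GenX
  | GenA => GenU
  | GenU => GenA
  | Comp _ _ _ a b => Comp (star b) (star a)
  | Tens _ _ _ _ a b => Tens (star a) (star b)
  | Zero _ _ => Zero
  | Add _ _ a b => Add (star a) (star b)
  | Scale _ _ c a => Scale c (star a)
  end.

Definition cast_expr k l k' l' (ek : k = k') (el : l = l') (a : expr k l) :
    expr k' l' :=
  ecast k0 (expr k0 l') ek (ecast l0 (expr k l0) el a).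

Fixpoint sharp k l (a : expr k l) : expr k l :=
  match a in expr k l return expr k l with
  | Empty => Empty
  | GenI => GenI
  | GenX => GenX
  | GenA => GenA
  | GenU => GenU
  | Comp _ _ _ a b => Comp (sharp a) (sharp b)
  | Tens p q k l a b =>
      cast_expr (addnC k p) (addnC l q) (Tens (sharp b) (sharp a))
  | Zero _ _ => Zero
  | Add _ _ a b => Add (sharp a) (sharp b)
  | Scale _ _ c a => Scale c (sharp a)
  end.

Inductive defining_relation : forall k l, expr k l -> expr k l -> Prop :=
| rel_II : defining_relation (Comp GenI GenI) GenI
| rel_IIX : defining_relation (Comp (Tens GenI GenI) GenX) GenX
| rel_AII : defining_relation (Comp GenA (Tens GenI GenI)) GenA
| rel_IIU : defining_relation (Comp (Tens GenI GenI) GenU) GenU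
| rel_XX : defining_relation (Comp GenX GenX) (Tens GenI GenI)
| rel_braid : defining_relation
    (Comp (Comp (Tens GenX GenI) (Tens GenI GenX)) (Tens GenX GenI))
    (Comp (Comp (Tens GenI GenX) (Tens GenX GenI)) (Tens GenI GenX))
| rel_AX : defining_relation (Comp GenA GenX) GenA
| rel_AU : defining_relation (Comp GenA GenU) (Scale delta Empty)
| rel_slide : defining_relation
    (Comp (Tens GenA GenI) (Tens GenI GenX))
    (Comp (Tens GenI GenA) (Tens GenX GenI))
| rel_straighten : defining_relation
    (Comp (Tens GenA GenI) (Tens GenI GenU)) GenI
| rel_star k l (a b : expr k l) :
    defining_relation a b -> defining_relation (star a) (star b)
| rel_sharp k l (a b : expr k l) :
    defining_relation a b -> defining_relation (sharp a) (sharp b).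

(** Deducing an equation between two words may pass through [K]-linear
    combinations of words, as in the relation for [A] after [U].
    Deducibility relates expressions whose types need only be propositionally
    equal, since both sides of associativity of the tensor product have types
    that differ by associativity of addition. *)
Inductive deducible :
    forall k l, expr k l -> forall k' l', expr k' l' -> Prop :=
| ded_relation k l (a b : expr k l) : defining_relation a b -> deducible a b
| ded_refl k l (a : expr k l) : deducible a a
| ded_sym k l (a : expr k l) k' l' (a' : expr k' l') :
    deducible a a' -> deducible a' a
| ded_trans k l (a : expr k l) k' l' (a' : expr k' l')
    k'' l'' (a'' : expr k'' l'') :
    deducible a a' -> deducible a' a'' -> deducible a a''
| ded_comp k l p (a : expr l p) (b : expr k l)
    k' l' p' (a' : expr l' p') (b' : expr k' l') :
    deducible a a' -> deducible b b' -> deducible (Comp a b) (Comp a' b')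
| ded_tens p q k l (a : expr p q) (b : expr k l)
    p' q' k' l' (a' : expr p' q') (b' : expr k' l') :
    deducible a a' -> deducible b b' -> deducible (Tens a b) (Tens a' b')
| ded_add k l (a b : expr k l) k' l' (a' b' : expr k' l') :
    deducible a a' -> deducible b b' -> deducible (Add a b) (Add a' b')
| ded_scale k l (c : K) (a : expr k l) k' l' (a' : expr k' l') :
    deducible a a' -> deducible (Scale c a) (Scale c a')
| ded_compA k l p q (a : expr p q) (b : expr l p) (c : expr k l) :
    deducible (Comp a (Comp b c)) (Comp (Comp a b) c)
| ded_tensA k l p q r s (a : expr k l) (b : expr p q) (c : expr r s) :
    deducible (Tens a (Tens b c)) (Tens (Tens a b) c)
(* The empty diagram is also the identity morphism of the object 0; the
   identities of the other objects are tensor powers of [GenI], and their unit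
   laws come from the relations. *)
| ded_tens0l k l (a : expr k l) : deducible (Tens Empty a) a
| ded_tens0r k l (a : expr k l) : deducible (Tens a Empty) a
| ded_comp0l k (a : expr k 0) : deducible (Comp Empty a) a
| ded_comp0r l (a : expr 0 l) : deducible (Comp a Empty) a
| ded_interchange k1 l1 p1 k2 l2 p2 (a1 : expr l1 p1) (a2 : expr l2 p2)
    (b1 : expr k1 l1) (b2 : expr k2 l2) :
    deducible (Comp (Tens a1 a2) (Tens b1 b2))
              (Tens (Comp a1 b1) (Comp a2 b2))
| ded_addA k l (a b c : expr k l) :
    deducible (Add a (Add b c)) (Add (Add a b) c)
| ded_addC k l (a b : expr k l) : deducible (Add a b) (Add b a)
| ded_add0 k l (a : expr k l) : deducible (Add Zero a) a
| ded_scaleA k l (c d : K) (a : expr k l) :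
    deducible (Scale c (Scale d a)) (Scale (c * d) a)
| ded_scale1 k l (a : expr k l) : deducible (Scale 1 a) a
| ded_scale0 k l (a : expr k l) : deducible (Scale 0 a) (@Zero k l)
| ded_scaleDr k l (c : K) (a b : expr k l) :
    deducible (Scale c (Add a b)) (Add (Scale c a) (Scale c b))
| ded_scaleDl k l (c d : K) (a : expr k l) :
    deducible (Scale (c + d) a) (Add (Scale c a) (Scale d a))
| ded_compDl k l p (a b : expr l p) (c : expr k l) :
    deducible (Comp (Add a b) c) (Add (Comp a c) (Comp b c))
| ded_compDr k l p (a : expr l p) (b c : expr k l) :
    deducible (Comp a (Add b c)) (Add (Comp a b) (Comp a c))
| ded_compZl k l p (c : K) (a : expr l p) (b : expr k l) :
    deducible (Comp (Scale c a) b) (Scale c (Comp a b))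
| ded_compZr k l p (c : K) (a : expr l p) (b : expr k l) :
    deducible (Comp a (Scale c b)) (Scale c (Comp a b))
| ded_tensDl p q k l (a b : expr p q) (c : expr k l) :
    deducible (Tens (Add a b) c) (Add (Tens a c) (Tens b c))
| ded_tensDr p q k l (a : expr p q) (b c : expr k l) :
    deducible (Tens a (Add b c)) (Add (Tens a b) (Tens a c))
| ded_tensZl p q k l (c : K) (a : expr p q) (b : expr k l) :
    deducible (Tens (Scale c a) b) (Scale c (Tens a b))
| ded_tensZr p q k l (c : K) (a : expr p q) (b : expr k l) :
    deducible (Tens a (Scale c b)) (Scale c (Tens a b)).

End BrauerCategory.

(* Main.v *)
Require Import Defs.
From Stdlib Require Import Setoid Morphisms.
From mathcomp Require Import all_boot all_order all_fingroup all_algebra.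

(** Diagrams are told apart by two-colourings of their nodes, and the relations
    bring every word to a normal form that the colourings determine.

    A diagram has a matrix with entries 0 and 1, whose rows and columns are the
    colourings of the lower and of the upper nodes by two colours: the entry is
    1 if both ends of each arc have the same colour. The matrix of a composite
    is the product of the matrices divided by 2 for each closed loop, as a loop
    can take either colour ([compatible_dcomp]), and the matrix determines the
    diagram ([monochrome_inj]). A word with value [delta ^+ N] times a diagram
    [D] has [2 ^ N] times the matrix of [D], from which [N] and [D] can be read
    off ([compatible_inj]). Hence an equation between words holds in the Brauer
    category as soon as the matrices agree ([eval_eq_of_entry]). The defining
    relations, associativity and the interchange law thereby become identities
    between sums over bit strings, and loops need not be followed through
    iterated composites.

    For completeness, an upper node can be bent down, an operation which the
    relations invert ([bendK]), so it suffices to treat words with no upper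
    node. Their normal form is a composite of arches, each joining the leftmost
    remaining strand to its partner. A crossing put below a normal form moves
    the end of an arch, passes through it, or exchanges the starts of two arches
    ([arch_cross], [exchange]), and in each case leaves a normal form
    ([nf_cross]). A cap at the left end creates an arch, a cup there closes a
    loop or turns an arch into crossings, and all other positions are reached by
    crossings. So every word is deducibly a power of [delta] times a normal form
    ([word_nf]). Normal forms with the same matrix are equal ([nf_inj]). If the
    normal forms of two words of equal value differ, the two powers of [delta]
    vanish in [K] and both words are deducibly zero ([deducible_of_eval0]).

    The diagrams are generated by the same process: the upper nodes of a diagram
    are bent down and its arcs removed one after the other as arches
    ([word_of_labels]). *)

Set Implicit Arguments.
Unset Strict Implicit.
Unset Printing Implicit Defensive.

Import GRing.Theory.

(** * Colourings of pairings *)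

Definition monochrome (T : finType) (P : {set {set T}}) (c : T -> bool) :=
  [forall B in P, [forall x in B, [forall y in B, c x == c y]]].

Lemma monochromeP (T : finType) (P : {set {set T}}) (c : T -> bool) :
  reflect (forall B x y, B \in P -> x \in B -> y \in B -> c x = c y)
    (monochrome P c).
Proof.
apply: (iffP forall_inP) => [h B x y BP xB yB|h B BP].
  by apply/eqP; move/forall_inP: (h B BP) => /(_ x xB)/forall_inP; apply.
by apply/forall_inP => x xB; apply/forall_inP => y yB; apply/eqP/(h B).
Qed.

Lemma eq_monochrome (T : finType) (P : {set {set T}}) (c c' : T -> bool) :
  c =1 c' -> monochrome P c = monochrome P c'.
Proof.
move=> E; apply/monochromeP/monochromeP => h B x y BP xB yB.
  by rewrite -!E (h B x y).
by rewrite !E (h B x y).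
Qed.

Lemma monochrome_imset (T T' : finType) (f : T -> T') (P : {set {set T}}) c :
  monochrome [set f @: B | B : {set T} in P] c = monochrome P (c \o f).
Proof.
apply/monochromeP/monochromeP => [h B x y BP xB yB /=|h C x' y'].
  by apply: (h (f @: B)); apply: imset_f.
by case/imsetP=> B BP -> /imsetP[x xB ->] /imsetP[y yB ->]; exact: (h B).
Qed.

Lemma monochromeU (T : finType) (P Q : {set {set T}}) c :
  monochrome (P :|: Q) c = monochrome P c && monochrome Q c.
Proof.
apply/monochromeP/andP => [h|[/monochromeP hP /monochromeP hQ] B x y].
  by split; apply/monochromeP => B x y BP; apply: h; rewrite inE BP ?orbT.
case/setUP; [exact: hP | exact: hQ].
Qed.

(** The indicator of a block of [P] is constant on the blocks of [P], hence on
    those of [Q]: a block of [Q] that meets a block of [P] lies inside it, and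
    both have two elements. *)
Lemma monochrome_inj (T : finType) (P Q : {set {set T}}) :
  is_pairing P -> is_pairing Q ->
  (forall c, monochrome P c = monochrome Q c) -> P = Q.
Proof.
suff sub (P1 Q1 : {set {set T}}) : is_pairing P1 -> is_pairing Q1 ->
    (forall c, monochrome P1 c = monochrome Q1 c) -> P1 \subset Q1.
  by move=> pP pQ E; apply/eqP; rewrite eqEsubset !sub.
move=> pP pQ E; have [/and3P[/eqP cQ tQ _] _] := andP pQ.
have [/and3P[_ tP _] _] := andP pP.
apply/subsetP => B BP; have cB := pairing_card pP BP.
have /card_gt0P[x xB] : 0 < #|B| by rewrite cB.
have xQ : x \in cover Q1 by rewrite cQ inE.
have fB : monochrome Q1 [in B].
  rewrite -E; apply/monochromeP => C y z CP yC zC /=.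
  have [BC|nBC] := eqVneq B C; first by rewrite BC yC zC.
  have/trivIsetP/(_ _ _ BP CP nBC) dBC := tP.
  by rewrite !(disjointFl dBC).
suff <- : pblock Q1 x = B by exact: pblock_mem.
apply/eqP; rewrite eqEcard cB (pairing_card pQ (pblock_mem xQ)) andbT.
apply/subsetP => y yx; have xx : x \in pblock Q1 x by rewrite mem_pblock.
by have /= <- := monochromeP _ _ fB _ _ _ (pblock_mem xQ) xx yx.
Qed.

(** * Colourings of a composite *)

Section CountColourings.

Variables (T V : finType) (e : rel T) (f : V -> T) (c : V -> bool).
Hypothesis e_sym : symmetric e.
Hypothesis c_compat : forall x y, connect e (f x) (f y) -> c x = c y.

Let csym : connect_sym e. Proof. exact: sym_connect_sym. Qed.

Let free := [set C in equivalence_partition (connect e) [set: T] |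
             [forall v, f v \notin C]].

Let class x := [set y in [set: T] | connect e x y].

Let h (A : {set {set T}}) : {ffun T -> bool} :=
  [ffun x => if [pick v | connect e x (f v)] is Some v then c v
             else class x \in A].

Let class_eq x y : connect e x y -> class x = class y.
Proof.
by move=> xy; apply/setP => z; rewrite !inE; exact: same_connect csym _ _ xy _.
Qed.

Lemma connect_const (g : T -> bool) :
  (forall x y, e x y -> g x = g y) -> forall x y, connect e x y -> g x = g y.
Proof.
move=> gE x y /connectP[p]; elim: p x => [|z p IH] x /=; first by move=> _ ->.
by case/andP=> /gE -> /IH h' /h'.
Qed.

(** A colouring that is constant along [e] amounts to one colour for each
    component. The components that [f] meets get their colour from [c], the
    others are free, so the colourings correspond to the sets of free
    components. *)
Lemma card_compatible_colourings :
  #|[set g : {ffun T -> bool} |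
      [forall x, forall y, e x y ==> (g x == g y)] &&
      [forall v, g (f v) == c v]]| = 2 ^ #|free|.
Proof.
rewrite -card_powerset -(card_in_imset (f := h)); last first.
  suff sub (A B : {set {set T}}) : A \subset free -> h A = h B -> A \subset B.
    move=> A B; rewrite !inE => sA sB hAB.
    by apply/eqP; rewrite eqEsubset; apply/andP; split; apply: sub.
  move=> /subsetP sA hAB; apply/subsetP => C CA; have := sA C CA.
  rewrite inE => /andP[/imsetP[x _ EC] /forallP nC].
  have E : [pick v | connect e x (f v)] = None.
    by case: pickP => // v xv; have := nC v; rewrite EC !inE xv.
  by have /ffunP/(_ x) := hAB; rewrite !ffunE E /class -EC CA.
apply: eq_card => g; apply/idP/imsetP => [|[A _ ->]]; last first.
  rewrite inE; apply/andP; split.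
    apply/forallP => x; apply/forallP => y; apply/implyP => /connect1 xy.
    rewrite !ffunE (class_eq xy).
    have /eq_pick -> // : (fun v => connect e x (f v)) =1
                          (fun v => connect e y (f v)).
    by move=> v; exact: same_connect csym _ _ xy _.
  apply/forallP => v; rewrite ffunE.
  case: pickP => [w|/(_ v)]; last by rewrite connect0.
  by move/c_compat ->.
rewrite inE => /andP[/forallP gE /forallP gf].
have gC : forall x y, connect e x y -> g x = g y.
  apply: connect_const => x y xy; apply/eqP.
  by have /forallP/(_ y)/implyP/(_ xy) := gE x.
exists [set C in free | [exists x in C, g x]].
  by rewrite inE; apply/subsetP => C; rewrite inE => /andP[].
apply/ffunP => x; rewrite ffunE; case: pickP => [v xv|nv].
  by rewrite (gC _ _ xv); apply/eqP.
rewrite inE [class x \in free]inE; symmetry.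
have -> : class x \in equivalence_partition (connect e) [set: T].
  by apply: imset_f; rewrite inE.
have -> : [forall v, f v \notin class x].
  by apply/forallP => v; rewrite !inE nv.
apply/exists_inP/idP => [[y]|gx]; last by exists x; rewrite // !inE connect0.
by rewrite !inE => /gC ->.
Qed.

End CountColourings.

Definition node_colour k l (s t : seq bool) (x : node k l) : bool :=
  match x with inl i => nth false s i | inr u => nth false t u end.

(** The colours of a row form a bit string, so that splitting a row for a tensor
    product needs no cast between types of nodes. *)
Definition compatible k l (D : brauer k l) (s t : seq bool) : bool :=
  monochrome (arcs D) (node_colour s t).

Section ColourGlued.

Variables (k l p : nat) (D1 : brauer l p) (D2 : brauer k l).
Let e := linked D1 D2.

Let e_sym : symmetric e.
Proof.
move=> x y; rewrite /e /linked.
by congr (_ || _); apply: eq_existsb => B; congr (_ && _); rewrite andbC.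
Qed.

Let csym : connect_sym e. Proof. exact: sym_connect_sym. Qed.

Lemma monochrome_linked (g : glued k l p -> bool) :
  reflect (forall x y, e x y -> g x = g y)
    (monochrome (arcs D2) (g \o @from_below k l p) &&
     monochrome (arcs D1) (g \o @from_above k l p)).
Proof.
apply: (iffP andP) => [[/monochromeP h2 /monochromeP h1] x y|h].
  case/orP => /exists_inP[B BD /andP[/imsetP[a aB ->] /imsetP[b bB ->]]].
    exact: (h2 B).
  exact: (h1 B).
split; apply/monochromeP => B x y BD xB yB /=; apply: h; apply/orP;
  [left | right];
  by apply/exists_inP; exists B => //; rewrite !imset_f.
Qed.

Lemma monochrome_comp_arcs (c : node k p -> bool) :
  reflect (forall x y, connect e (from_outer l x) (from_outer l y) -> c x = c y)
    (monochrome (comp_arcs D1 D2) c).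
Proof.
apply: (iffP (monochromeP _ _)) => [h x y xy|h _ x y /imsetP[z _ ->]].
  apply: (h [set z in [set: node k p] |
               connect e (from_outer l x) (from_outer l z)]).
  - by apply: imset_f; rewrite inE.
  - by rewrite !inE connect0.
  - by rewrite !inE.
rewrite !inE => zx zy; apply: h.
by apply: connect_trans zy; rewrite csym.
Qed.

Variables s t : seq bool.

Let extend (m : l.-tuple bool) : {ffun glued k l p -> bool} :=
  [ffun x : glued k l p =>
     match x with inl y => node_colour s m y | inr u => nth false t u end].

Let extend_inj : injective extend.
Proof.
move=> m m' /ffunP E; apply: eq_from_tnth => j.
by have := E (inl (inr j)); rewrite !ffunE /= -!tnth_nth.
Qed.

(** The colourings of the middle row that suit both diagrams are the extensions
    of the outer colouring to the glued picture. There are none if some arc of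
    the composite has ends of different colours; otherwise the colours are
    forced except on the closed loops, each of which takes either colour. *)
Lemma compatible_dcomp :
  \sum_(m : l.-tuple bool) compatible D2 s m * compatible D1 m t =
  2 ^ loops D1 D2 * compatible (dcomp D1 D2) s t.
Proof.
have -> : \sum_(m : l.-tuple bool) compatible D2 s m * compatible D1 m t =
    #|[set m : l.-tuple bool | compatible D2 s m && compatible D1 m t]|.
  rewrite -sum1_card [RHS]big_mkcond /=; apply: eq_bigr => m _.
  by rewrite inE mulnb; case: (_ && _).
rewrite -(card_imset _ extend_inj).
have -> : [set extend m | m in
      [set m : l.-tuple bool | compatible D2 s m && compatible D1 m t]] =
    [set g : {ffun glued k l p -> bool} |
      [forall x, forall y, e x y ==> (g x == g y)] &&
      [forall v : node k p, g (from_outer l v) == node_colour s t v]].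
  have valid (m : l.-tuple bool) : compatible D2 s m && compatible D1 m t =
      [forall x, forall y, e x y ==> (extend m x == extend m y)].
    have below : node_colour s m =1 extend m \o @from_below k l p.
      by case=> i /=; rewrite ffunE.
    have above : node_colour m t =1 extend m \o @from_above k l p.
      by case=> i /=; rewrite ffunE.
    rewrite /compatible (eq_monochrome _ below) (eq_monochrome _ above).
    apply/monochrome_linked/forallP => [h x|h x y xy].
      by apply/forallP => y; apply/implyP => /h ->.
    by apply/eqP; have /forallP/(_ y)/implyP/(_ xy) := h x.
  apply/setP => g; apply/imsetP/idP => [[m]|]; rewrite !inE.
    by rewrite valid => v ->; rewrite v; apply/forallP => -[] i; rewrite ffunE.
  case/andP=> gE /forallP gf.
  have E : g = extend [tuple g (inl (inr j)) | j < l].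
    apply/ffunP => -[[i|j]|u]; rewrite ffunE.
    - exact/eqP/(gf (inl i)).
    - symmetry; apply: etrans (esym (tnth_nth false _ j)) _.
      by rewrite tnth_mktuple.
    - exact/eqP/(gf (inr u)).
  by exists [tuple g (inl (inr j)) | j < l]; rewrite // inE valid -E.
have [/monochrome_comp_arcs cc|nc] := boolP (compatible (dcomp D1 D2) s t).
  by rewrite muln1; exact: card_compatible_colourings.
rewrite muln0; apply: eq_card0 => g; rewrite inE; apply/negP.
case/andP=> /forallP gE /forallP gf; case/negP: nc; apply/monochrome_comp_arcs.
move=> x y xy; rewrite -(eqP (gf x)) -(eqP (gf y)).
apply: (connect_const (e := e)) xy => {}x {}y xy; apply/eqP.
by have /forallP/(_ y)/implyP/(_ xy) := gE x.
Qed.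

End ColourGlued.

(** * The relations on any number of strands *)

Section Deduction.

Variables (K : comPzRingType) (delta : K).

(** Deducibility between expressions of the same type, where rewriting is
    available. *)
Definition ded k l (a b : expr K k l) : Prop := deducible delta a b.

Local Notation "a === b" := (ded a b) (at level 70, no associativity).
Local Notation "a ∘ b" := (Comp a b) (at level 40, left associativity).
Local Notation I := (GenI K).
Local Notation X := (GenX K).
Local Notation A := (GenA K).
Local Notation U := (GenU K).

#[local] Instance ded_equivalence k l : Equivalence (@ded k l).
Proof.
split; first by move=> a; exact: ded_refl.
  by move=> a b; exact: ded_sym.
by move=> a b c; exact: ded_trans.
Qed.

#[local] Hint Extern 0 (ded _ _) => reflexivity : core.

#[local] Instance Comp_proper k l p :
  Proper (@ded l p ==> @ded k l ==> @ded k p) (@Comp K k l p).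
Proof. by move=> a a' aa' b b' bb'; exact: ded_comp. Qed.

#[local] Instance Tens_proper p q k l :
  Proper (@ded p q ==> @ded k l ==> @ded (p + k) (q + l)) (@Tens K p q k l).
Proof. by move=> a a' aa' b b' bb'; exact: ded_tens. Qed.

#[local] Instance Scale_proper k l (c : K) :
  Proper (@ded k l ==> @ded k l) (@Scale K k l c).
Proof. by move=> a a' aa'; exact: ded_scale. Qed.

Lemma compA k l p q (a : expr K p q) (b : expr K l p) (c : expr K k l) :
  a ∘ (b ∘ c) === a ∘ b ∘ c.
Proof. exact: ded_compA. Qed.

Fixpoint ids n : expr K n n :=
  match n with 0 => Empty K | n'.+1 => Tens I (ids n') end.

(** Every generator acts on the leftmost strands, and [up] moves it to the
    right. With the identities always on the right, the numbers of strands on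
    the two sides of each identity below are convertible, and no cast is
    needed. *)
Definition up n m (a : expr K n m) : expr K n.+1 m.+1 := Tens I a.
Definition swap n : expr K n.+2 n.+2 := Tens X (ids n).
Definition cap n : expr K n.+2 n := Tens A (ids n).
Definition cup n : expr K n n.+2 := Tens U (ids n).

#[local] Instance up_proper n m :
  Proper (@ded n m ==> @ded n.+1 m.+1) (@up n m).
Proof. by move=> a a' aa'; exact: (ded_tens (ded_refl delta I) aa'). Qed.

Definition rel_ded k l (a b : expr K k l) (r : defining_relation delta a b) :
  a === b := ded_relation r.

Lemma ded_deducible k l (a b : expr K k l) : a === b -> deducible delta a b.
Proof. by []. Qed.

Lemma ids_tens k l : deducible delta (Tens (ids k) (ids l)) (ids (k + l)).
Proof.
elim: k => [|k IH] /=; first exact: ded_tens0l.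
apply: (ded_trans (ded_sym (ded_tensA delta I (ids k) (ids l)))).
exact: (ded_tens (ded_refl delta I) IH).
Qed.

Lemma Zero_scale k l (a : expr K k l) : Zero K k l === Scale 0%R a.
Proof. by apply: ded_sym; exact: ded_scale0. Qed.

Lemma compZl k l p c (a : expr K l p) (b : expr K k l) :
  Scale c a ∘ b === Scale c (a ∘ b).
Proof. exact: ded_compZl. Qed.

Lemma compZr k l p c (a : expr K l p) (b : expr K k l) :
  a ∘ Scale c b === Scale c (a ∘ b).
Proof. exact: ded_compZr. Qed.

Lemma Zero_comp k l p (b : expr K k l) : Zero K l p ∘ b === Zero K k p.
Proof.
by rewrite (Zero_scale (Zero K l p)) compZl -Zero_scale.
Qed.

(** For the generators this is among the relations; through a tensor product the
    unit laws pass by the interchange law. *)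
Lemma comp_ids k l (a : expr K k l) : ids l ∘ a === a /\ a ∘ ids k === a.
Proof.
have I1 : deducible delta I (ids 1) := ded_sym (ded_tens0r delta I).
have I2 : deducible delta (Tens I I) (ids 2).
  exact: (ded_tens (ded_refl delta I) I1).
elim: k l / a.
- by split; apply: ded_comp0l.
- by rewrite -(I1 : I === ids 1); split; exact: rel_ded (rel_II _).
- rewrite -(I2 : Tens I I === ids 2); split; first exact: rel_ded (rel_IIX _).
  exact: rel_ded (rel_star (rel_IIX _)).
- split; first exact: ded_comp0l.
  by rewrite -(I2 : Tens I I === ids 2); exact: rel_ded (rel_AII _).
- split; last exact: ded_comp0r.
  by rewrite -(I2 : Tens I I === ids 2); exact: rel_ded (rel_IIU _).
- move=> k l p a [a1 _] b [_ b2].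
  by rewrite compA a1 -compA b2.
- move=> p q k l a [a1 a2] b [b1 b2]; split.
    apply: ded_trans (ded_comp (ded_sym (ids_tens _ _)) (ded_refl _ _)) _.
    by apply: ded_trans (ded_interchange _ _ _ _ _) _; exact: ded_tens.
  apply: ded_trans (ded_comp (ded_refl _ _) (ded_sym (ids_tens _ _))) _.
  by apply: ded_trans (ded_interchange _ _ _ _ _) _; exact: ded_tens.
- move=> k l; split; rewrite (Zero_scale (Zero K k l)).
    by rewrite compZr -!Zero_scale.
  by rewrite compZl -!Zero_scale.
- move=> k l a [a1 a2] b [b1 b2]; split.
    apply: ded_trans (ded_compDr _ _ _ _) _; exact: ded_add.
  apply: ded_trans (ded_compDl _ _ _ _) _; exact: ded_add.
- by move=> k l c a [a1 a2]; rewrite compZl compZr a1 a2.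
Qed.

Lemma comp1l k l (a : expr K k l) : ids l ∘ a === a.
Proof. by case: (comp_ids a). Qed.

Lemma comp1r k l (a : expr K k l) : a ∘ ids k === a.
Proof. by case: (comp_ids a). Qed.

Lemma tens_comp k1 l1 p1 k2 l2 p2 (a1 : expr K l1 p1) (a2 : expr K l2 p2)
    (b1 : expr K k1 l1) (b2 : expr K k2 l2) :
  Tens a1 a2 ∘ Tens b1 b2 === Tens (a1 ∘ b1) (a2 ∘ b2).
Proof. exact: ded_interchange. Qed.

Lemma II : I ∘ I === I. Proof. exact: rel_ded (rel_II _). Qed.

Lemma up_comp n m p (a : expr K m p) (b : expr K n m) :
  up (a ∘ b) === up a ∘ up b.
Proof. by rewrite /up (tens_comp (k1 := 1) (l1 := 1) (p1 := 1)) II. Qed.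

Lemma up_up n m (a : expr K n m) : up (up a) === Tens (ids 2) a.
Proof.
have e2 := ded_tens (ded_refl delta I) (ded_sym (ded_tens0r delta I)).
exact: (ded_trans (ded_tensA delta I I a) (ded_tens e2 (ded_refl delta a))).
Qed.

(** By interchange, what happens on the first two strands is independent of what
    happens on the others; the same reason gives [cap_nat] and [cup_nat]. *)
Lemma swap_nat n m (a : expr K n m) :
  swap m ∘ up (up a) === up (up a) ∘ swap n.
Proof.
rewrite !up_up /swap !(tens_comp (k1 := 2) (l1 := 2) (p1 := 2)).
by rewrite !comp1l !comp1r.
Qed.

Lemma cap_nat n m (a : expr K n m) : cap m ∘ up (up a) === a ∘ cap n.
Proof.
rewrite up_up /cap (tens_comp (k1 := 2) (l1 := 2) (p1 := 0)) comp1l comp1r.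
have E : a === Tens (Empty K) a by apply: ded_sym; exact: ded_tens0l.
rewrite [X in _ === X ∘ _]E (tens_comp (k1 := 2) (l1 := 0) (p1 := 0)) comp1r.
by rewrite (comp1l A).
Qed.

Lemma cup_nat n m (a : expr K n m) : up (up a) ∘ cup n === cup m ∘ a.
Proof.
rewrite up_up /cup (tens_comp (k1 := 0) (l1 := 2) (p1 := 2)) comp1l comp1r.
have E : a === Tens (Empty K) a by apply: ded_sym; exact: ded_tens0l.
rewrite [X in _ === _ ∘ X]E (tens_comp (k1 := 0) (l1 := 0) (p1 := 2)) comp1l.
by rewrite (comp1r U).
Qed.

(** The relations between generators side by side live on three strands; the
    next identities present the two positions there as tensor products with the
    remaining identity strands. *)
Lemma up_pad k l n (a : expr K k l) :
  up (Tens a (ids n)) === Tens (Tens I a) (ids n).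
Proof. exact: (ded_tensA delta I a (ids n)). Qed.

Lemma pad_up k l n (a : expr K k l) :
  deducible delta (Tens a (ids n.+1)) (Tens (Tens a I) (ids n)).
Proof. exact: (ded_tensA delta a I (ids n)). Qed.

Lemma swap_pad n : swap n.+1 === Tens (Tens X I) (ids n).
Proof. exact: (pad_up n X). Qed.
Lemma cap_pad n : cap n.+1 === Tens (Tens A I) (ids n).
Proof. exact: (pad_up n A). Qed.
Lemma cup_pad n : cup n.+1 === Tens (Tens U I) (ids n).
Proof. exact: (pad_up n U). Qed.
Lemma up_swap_pad n : up (swap n) === Tens (Tens I X) (ids n).
Proof. exact: (up_pad n X). Qed.
Lemma up_cap_pad n : up (cap n) === Tens (Tens I A) (ids n).
Proof. exact: (up_pad n A). Qed.
Lemma up_cup_pad n : up (cup n) === Tens (Tens I U) (ids n).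
Proof. exact: (up_pad n U). Qed.

Lemma swapK n : swap n ∘ swap n === ids n.+2.
Proof.
rewrite /swap (tens_comp (k1 := 2) (l1 := 2) (p1 := 2)) comp1l.
rewrite (rel_ded (rel_XX delta)).
exact: (ded_sym (ded_tensA delta I I (ids n))).
Qed.

Lemma braid n :
  swap n.+1 ∘ up (swap n) ∘ swap n.+1 ===
  up (swap n) ∘ swap n.+1 ∘ up (swap n).
Proof.
rewrite swap_pad up_swap_pad !(tens_comp (k1 := 3) (l1 := 3) (p1 := 3)) !comp1l.
by rewrite (rel_ded (rel_braid delta)).
Qed.

Lemma cap_swap n : cap n ∘ swap n === cap n.
Proof.
rewrite /cap /swap (tens_comp (k1 := 2) (l1 := 2) (p1 := 0)) comp1l.
by rewrite (rel_ded (rel_AX delta)).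
Qed.

Lemma swap_cup n : swap n ∘ cup n === cup n.
Proof.
rewrite /cup /swap (tens_comp (k1 := 0) (l1 := 2) (p1 := 2)) comp1l.
by rewrite (rel_ded (rel_star (rel_AX delta)) : X ∘ U === U).
Qed.

Lemma cap_cup n : cap n ∘ cup n === Scale delta (ids n).
Proof.
rewrite /cap /cup (tens_comp (k1 := 0) (l1 := 2) (p1 := 0)) comp1l.
rewrite (rel_ded (rel_AU delta)).
exact: (ded_trans (ded_tensZl delta delta (Empty K) (ids n))
                  (ded_scale delta (ded_tens0l delta (ids n)))).
Qed.

Lemma cap_slide n : cap n.+1 ∘ up (swap n) === up (cap n) ∘ swap n.+1.
Proof.
rewrite cap_pad up_swap_pad up_cap_pad swap_pad.
rewrite !(tens_comp (k1 := 3) (l1 := 3) (p1 := 1)).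
by rewrite (rel_ded (rel_slide delta)).
Qed.

Lemma cup_slide n : up (swap n) ∘ cup n.+1 === swap n.+1 ∘ up (cup n).
Proof.
rewrite cup_pad up_swap_pad up_cup_pad swap_pad.
rewrite !(tens_comp (k1 := 1) (l1 := 3) (p1 := 3)).
by rewrite (rel_ded (rel_star (rel_slide delta)) :
  Tens I X ∘ Tens U I === Tens X I ∘ Tens I U).
Qed.

Lemma up_cap_cup n : up (cap n) ∘ cup n.+1 === ids n.+1.
Proof.
rewrite cup_pad up_cap_pad !(tens_comp (k1 := 1) (l1 := 3) (p1 := 1)).
by rewrite (rel_ded (rel_star (rel_straighten delta)) :
  Tens I A ∘ Tens U I === I) comp1l.
Qed.

(** * Arches and normal forms *)

(** Joins strand [0] to strand [j.+1] by an arc that passes over the strands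
    between. A value of [j] above [n] acts as [n], the last possible end. *)
Fixpoint arch n (j : nat) {struct n} : expr K n.+2 n :=
  match n with
  | 0 => cap 0
  | m.+1 => match j with
            | 0 => cap m.+1
            | j'.+1 => up (arch m j') ∘ swap m.+1
            end
  end.

Lemma arch0 n : arch n 0 = cap n. Proof. by case: n. Qed.

(** Crosses the strands [i] and [i.+1]; the identity if there are no such
    strands. *)
Fixpoint cross n (i : nat) {struct n} : expr K n n :=
  match n with
  | 0 => ids 0
  | m.+1 => match i with
            | 0 => match m with 0 => ids 1 | p.+1 => swap p end
            | i'.+1 => up (cross m i')
            end
  end.

(** A crossing that does not involve the start of an arch either has the end of
    the arch on one of its strands, and moves this end, or passes through. *)
Lemma arch_cross n j i :
  (exists j', arch n j ∘ up (cross n.+1 i) === arch n j') \/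
  (exists i', arch n j ∘ up (cross n.+1 i) === cross n i' ∘ arch n j).
Proof.
elim: n j i => [|n IH] j i.
  left; exists 0; case: i => [|i]; exact: comp1r.
case: j => [|j]; case: i => [|i].
- by left; exists 1; rewrite /= arch0 cap_slide.
- by right; exists i; exact: cap_nat.
- case: n IH => [|n] IH.
    left; exists 0; rewrite /= -cap_slide -compA -up_comp swapK.
    exact: comp1r.
  case: j => [|j]; first by left; exists 0;
    rewrite /= -cap_slide -compA -up_comp swapK; exact: comp1r.
  right; exists 0 => /=.
  rewrite !up_comp -2!compA (compA (up (swap _))) -braid -!compA.
  by rewrite (compA (swap n)) swap_nat -!compA.
- have E : arch n.+1 j.+1 ∘ up (cross n.+2 i.+1) ===
           up (arch n j ∘ up (cross n.+1 i)) ∘ swap n.+1.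
    by rewrite [arch _ _]/= -compA swap_nat compA -up_comp.
  case: (IH j i) => -[r Er]; [left | right]; exists r.+1; rewrite E Er //.
  by rewrite up_comp -compA.
Qed.

Lemma up_cap n : up (cap n) === cap n.+1 ∘ up (swap n) ∘ swap n.+1.
Proof. by rewrite cap_slide -compA swapK comp1r. Qed.

(** The case of [exchange] where the arch that starts on the left ends at the
    first strand left over by the other one. *)
Lemma exchange_cap n i : exists j' i',
  cap n ∘ up (arch n.+1 i) === arch n j' ∘ up (arch n.+1 i') ∘ swap n.+2.
Proof.
case: i => [|i].
  by exists 0, 1; rewrite /= !arch0 up_cap up_comp !compA -cap_nat.
exists i, 0; rewrite /= up_comp compA cap_nat.
by rewrite -!compA cap_slide.
Qed.

(** On both sides the strands [0] and [1] are the starts of two arches;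
    exchanging these starts gives a picture of the same kind. If both arches
    pass over the next strand, it can be removed by the braid relation, which
    is the inductive step. *)
Lemma exchange n j i : exists j' i',
  arch n j ∘ up (arch n.+1 i) === arch n j' ∘ up (arch n.+1 i') ∘ swap n.+2.
Proof.
elim: n j i => [|n IH] [|j] i; try exact: exchange_cap.
case: i => [|i].
  exists 0, j.+2; rewrite /= up_cap !up_comp !compA.
  rewrite -(compA (up _)) -cap_nat.
  by rewrite [X in X ∘ up (swap n.+2)]compA -cap_nat.
have [j' [i' E]] := IH j i.
exists j'.+1, i'.+1; rewrite /= !up_comp.
rewrite compA -(compA _ (swap n.+1)) swap_nat compA -up_comp E.
rewrite !up_comp -2!compA (compA (up (swap _))) -braid.
by rewrite -!compA (compA (swap n.+1)) swap_nat -!compA.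
Qed.

(** The strand [0] is joined to its partner by an arch, and the strands left
    over are treated likewise; [c] lists the ends of the successive arches. An
    odd number of strands cannot be paired off, and [Zero] fills that case. *)
Fixpoint nf n (c : seq nat) {struct n} : expr K n 0 :=
  match n with
  | 0 => Empty K
  | 1 => Zero K 1 0
  | m.+2 => nf m (behead c) ∘ arch m (head 0 c)
  end.

Lemma nfSS n c : nf n.+2 c = nf n (behead c) ∘ arch n (head 0 c).
Proof. by []. Qed.

Lemma archS n j : arch n.+1 j.+1 = up (arch n j) ∘ swap n.+1.
Proof. by []. Qed.

(** A crossing away from strand [0] is handled by [arch_cross] and, if it passes
    the first arch, by induction. A crossing of the strands [0] and [1] is
    absorbed if these are joined, and otherwise exchanges the starts of the
    first two arches. *)
Lemma nf_cross n c i : exists c', nf n c ∘ cross n i === nf n c'.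
Proof.
elim/ltn_ind: n c i => -[|[|n]] IH c i; first by exists c; exact: comp1r.
  by exists c; exact: Zero_comp.
case: i => [|i]; last first.
  have [[j E]|[i' E]] := arch_cross n (head 0 c) i.
    by exists (j :: behead c); rewrite [nf _ c]/= -compA E.
  have [//|c' Ec] := IH n _ (behead c) i'.
  by exists (head 0 c :: c'); rewrite [nf _ c]/= -compA E compA Ec.
case Ej: (head 0 c) => [|j].
  by exists c; rewrite [nf _ c]/= Ej arch0 -compA cap_swap.
case: n IH => [|[|n]] IH.
- by exists c; rewrite /= -compA cap_swap.
- exists c; apply: (transitivity (y := Zero K 3 0)); rewrite /= -?compA.
    exact: Zero_comp.
  by symmetry; exact: Zero_comp.
- have [j' [i' E]] := exchange n (head 0 (behead c)) j.
  exists (i'.+1 :: j' :: behead (behead c)).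
  rewrite nfSS Ej archS -(compA (nf _ _)) -(compA (up _)) swapK comp1r.
  by rewrite nfSS -compA E !nfSS [head _ _]/= archS -!compA.
Qed.

(** * Reduction of words to normal forms *)

Lemma deducible_type k l (a : expr K k l) k' l' (a' : expr K k' l') :
  deducible delta a a' -> k = k' /\ l = l'.
Proof.
by elim=> *; rewrite ?addnA ?addn0 ?add0n; split;
   repeat match goal with H : _ /\ _ |- _ => case: H => ? ? end; congruence.
Qed.

(** Closure under deducibility between different types lets padding by
    identities be reassociated without casts. *)
Inductive crossings : forall n, expr K n n -> Prop :=
| crossings_ids n : crossings (ids n)
| crossings_cross n i : crossings (cross n i)
| crossings_comp n (a b : expr K n n) :
    crossings a -> crossings b -> crossings (a ∘ b)
| crossings_ded n (a : expr K n n) n' (a' : expr K n' n') :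
    deducible delta a a' -> crossings a' -> crossings a.

Lemma up_deducible n m (a : expr K n m) n' m' (a' : expr K n' m') :
  deducible delta a a' -> deducible delta (up a) (up a').
Proof. exact: (ded_tens (ded_refl delta I)). Qed.

Lemma crossings_up n (a : expr K n n) : crossings a -> crossings (up a).
Proof.
elim=> {n a} [n|n i|n a b _ IHa _ IHb|n a n' a' E _ IH].
- exact: (crossings_ids n.+1).
- exact: (crossings_cross n.+1 i.+1).
- by apply: crossings_ded (up_comp a b) _; exact: crossings_comp.
- by apply: crossings_ded (up_deducible E) _.
Qed.

Lemma pad_up_expr n m (a : expr K n m) j :
  deducible delta (Tens (up a) (ids j)) (up (Tens a (ids j))).
Proof. exact: ded_sym (ded_tensA delta I a (ids j)). Qed.

Lemma pad_gen p q n j (g : expr K p q) :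
  deducible delta (Tens (Tens g (ids n)) (ids j)) (Tens g (ids (n + j))).
Proof.
apply: (ded_trans (ded_sym (ded_tensA delta g (ids n) (ids j)))).
exact: (ded_tens (ded_refl delta g) (ids_tens n j)).
Qed.

Lemma pad_comp n m p j (a : expr K m p) (b : expr K n m) :
  Tens (a ∘ b) (ids j) === Tens a (ids j) ∘ Tens b (ids j).
Proof. by rewrite tens_comp comp1l. Qed.

Lemma crossings_pad n (a : expr K n n) j :
  crossings a -> crossings (Tens a (ids j)).
Proof.
elim=> {n a} [n|n i|n a b _ IHa _ IHb|n a n' a' E _ IH].
- by apply: crossings_ded (ids_tens n j) _; exact: crossings_ids.
- elim: n i => [|n IH] [|i].
  + by apply: crossings_ded (ids_tens 0 j) _; exact: crossings_ids.
  + by apply: crossings_ded (ids_tens 0 j) _; exact: crossings_ids.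
  + case: n {IH} => [|n].
      by apply: crossings_ded (ids_tens 1 j) _; exact: crossings_ids.
    apply: crossings_ded (pad_gen n j X) _.
    exact: (crossings_cross (n + j).+2 0).
  + apply: crossings_ded (pad_up_expr (cross n i) j) _.
    exact: crossings_up.
- by apply: crossings_ded (pad_comp j a b) _; exact: crossings_comp.
- exact: crossings_ded (ded_tens E (ded_refl delta (ids j))) _.
Qed.

Definition reduces n m (e : expr K n m) : Prop :=
  forall c, exists N c', nf m c ∘ e === Scale (delta ^+ N)%R (nf n c').

Lemma scaleA k l c d (a : expr K k l) :
  Scale c (Scale d a) === Scale (c * d)%R a.
Proof. exact: ded_scaleA. Qed.

Lemma scale1 k l (a : expr K k l) : Scale 1%R a === a.
Proof. exact: ded_scale1. Qed.

Lemma reduces_ded n m (e e' : expr K n m) :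
  e === e' -> reduces e' -> reduces e.
Proof. by move=> E r c; have [N [c' Ec]] := r c; exists N, c'; rewrite E. Qed.

Lemma reduces_comp n m p (a : expr K m p) (b : expr K n m) :
  reduces a -> reduces b -> reduces (a ∘ b).
Proof.
move=> ra rb c; have [N [c' Ec]] := ra c; have [N' [c'' Ec']] := rb c'.
by exists (N + N'), c''; rewrite compA Ec compZl Ec' scaleA exprD.
Qed.

Lemma reduces_free n m (e : expr K n m) :
  (forall c, exists c', nf m c ∘ e === nf n c') -> reduces e.
Proof. by move=> r c; have [c' Ec] := r c; exists 0, c'; rewrite scale1. Qed.

Lemma reduces_crossings n (a : expr K n n) : crossings a -> reduces a.
Proof.
elim=> {n a} [n|n i|n a b _ IHa _ IHb|n a n' a' E _ IH].
- by apply: reduces_free => c; exists c; exact: comp1r.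
- by apply: reduces_free => c; exact: nf_cross.
- exact: reduces_comp.
- have [En _] := deducible_type E; case: n' / En a' E IH => a' E.
  exact: reduces_ded.
Qed.

Lemma reduces_cap n : reduces (cap n).
Proof. by apply: reduces_free => c; exists (0 :: c); rewrite nfSS arch0. Qed.

(** The cup starts where the arch starts, so the two straighten to a single
    strand, which still crosses the strands that the arch passes over. *)
Lemma crossings_arch_cup n j : crossings (up (arch n j) ∘ cup n.+1).
Proof.
elim: n j => [|n IH] [|j];
  try by apply: crossings_ded (up_cap_cup _) _; exact: crossings_ids.
apply: (crossings_ded (a' := swap n ∘ up (up (arch n j) ∘ cup n.+1))).
  apply: ded_deducible; rewrite archS !up_comp -compA.
  by rewrite [up (swap _) ∘ _]cup_slide !compA swap_nat.
apply: crossings_comp; first exact: (crossings_cross n.+2 0).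
exact: crossings_up.
Qed.

(** The cup joins the start of the first arch to strand [1]: it closes a loop if
    the arch ends there, and otherwise turns the arch into crossings. *)
Lemma reduces_cup n : reduces (cup n).
Proof.
move=> c; rewrite nfSS.
have base d : exists N c', nf n d ∘ cap n ∘ cup n ===
                           Scale (delta ^+ N)%R (nf n c').
  by exists 1, d; rewrite -compA cap_cup compZr comp1r expr1.
case: n c base => [|n] c base; first exact: base.
case: (head 0 c) => [|j]; first exact: base.
have [N [c' E]] := reduces_crossings (crossings_arch_cup n j) (behead c).
by exists N, c'; rewrite archS -!compA swap_cup.
Qed.

(** Caps and cups are required at the left end only: by [up_cap] and
    [cup_slide], crossings bring them there from any other position. *)
Inductive layered : forall n m, expr K n m -> Prop :=
| layered_crossings n (a : expr K n n) : crossings a -> layered a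
| layered_cap n : layered (cap n)
| layered_cup n : layered (cup n)
| layered_comp n m p (a : expr K m p) (b : expr K n m) :
    layered a -> layered b -> layered (a ∘ b)
| layered_ded n m (a : expr K n m) n' m' (a' : expr K n' m') :
    deducible delta a a' -> layered a' -> layered a.

Lemma reduces_layered n m (e : expr K n m) : layered e -> reduces e.
Proof.
elim=> {n m e} [n a|n|n|n m p a b _ IHa _ IHb|n m a n' m' a' E _ IH].
- exact: reduces_crossings.
- exact: reduces_cap.
- exact: reduces_cup.
- exact: reduces_comp.
- have [En Em] := deducible_type E.
  case: n' / En a' E IH => a' E IH; case: m' / Em a' E IH => a' E.
  exact: reduces_ded.
Qed.

Lemma layered_swap n : layered (swap n).
Proof. by apply: layered_crossings; exact: (crossings_cross n.+2 0). Qed.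

Lemma layered_up n m (e : expr K n m) : layered e -> layered (up e).
Proof.
have up_swap p : layered (up (swap p)).
  by apply: layered_crossings; exact: (crossings_cross p.+3 1).
elim=> {n m e} [n a ca|n|n|n m p a b _ IHa _ IHb|n m a n' m' a' E _ IH].
- by apply: layered_crossings; exact: crossings_up.
- apply: layered_ded (up_cap n) _.
  apply: layered_comp; last exact: layered_swap.
  by apply: layered_comp; first exact: layered_cap.
- apply: (layered_ded (a' := swap n.+1 ∘ (up (swap n) ∘ cup n.+1))).
    by apply: ded_deducible; rewrite cup_slide compA swapK comp1l.
  apply: layered_comp; first exact: layered_swap.
  by apply: layered_comp; last exact: layered_cup.
- by apply: layered_ded (up_comp a b) _; exact: layered_comp.
- by apply: layered_ded (up_deducible E) _.
Qed.

Lemma layered_padl i n m (e : expr K n m) :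
  layered e -> layered (Tens (ids i) e).
Proof.
move=> le; elim: i => [|i IH]; first exact: layered_ded (ded_tens0l delta e) le.
apply: layered_ded (ded_sym (ded_tensA delta I (ids i) e)) _.
exact: layered_up.
Qed.

Lemma layered_padr j n m (e : expr K n m) :
  layered e -> layered (Tens e (ids j)).
Proof.
elim=> {n m e} [n a ca|n|n|n m p a b _ IHa _ IHb|n m a n' m' a' E _ IH].
- by apply: layered_crossings; exact: crossings_pad.
- by apply: layered_ded (pad_gen n j A) _; exact: (layered_cap (n + j)).
- by apply: layered_ded (pad_gen n j U) _; exact: (layered_cup (n + j)).
- by apply: layered_ded (pad_comp j a b) _; exact: layered_comp.
- exact: layered_ded (ded_tens E (ded_refl delta (ids j))) _.
Qed.

(** A tensor product is cut into two slices, [a] beside identities above [b]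
    beside identities. *)
Lemma layered_word n m (w : expr K n m) : is_word w -> layered w.
Proof.
elim: n m / w => //.
- by move=> _; apply: layered_crossings; exact: (crossings_ids 0).
- move=> _; apply: layered_ded (ded_sym (ded_tens0r delta I)) _.
  by apply: layered_crossings; exact: (crossings_ids 1).
- move=> _; apply: layered_ded (ded_sym (ded_tens0r delta X)) _.
  exact: (layered_swap 0).
- move=> _; apply: layered_ded (ded_sym (ded_tens0r delta A)) _.
  exact: (layered_cap 0).
- move=> _; apply: layered_ded (ded_sym (ded_tens0r delta U)) _.
  exact: (layered_cup 0).
- by move=> k l p a IHa b IHb /= /andP[/IHa la /IHb lb]; exact: layered_comp.
- move=> p q k l a IHa b IHb /= /andP[/IHa la /IHb lb].
  apply: (layered_ded (a' := Tens a (ids l) ∘ Tens (ids p) b)).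
    by apply: ded_deducible; rewrite tens_comp comp1l comp1r.
  by apply: layered_comp; [exact: layered_padr | exact: layered_padl].
Qed.

(** The word is placed below the empty normal form. *)
Lemma word_nf n (w : expr K n 0) :
  is_word w -> exists N c, w === Scale (delta ^+ N)%R (nf n c).
Proof.
move=> /layered_word/reduces_layered/(_ [::])[N [c E]]; exists N, c.
by rewrite -E; apply: ded_sym; exact: ded_comp0l.
Qed.

(** [bend] turns the first upper node into a lower one, [unbend] turns it
    back. *)
Definition bend n m (a : expr K n m.+1) : expr K n.+1 m := cap m ∘ up a.
Definition unbend n m (a : expr K n.+1 m) : expr K n m.+1 := up a ∘ cup n.

(** Both bends of the strand cancel by the straightening relation. *)
Lemma bendK n m (a : expr K n m.+1) : unbend (bend a) === a.
Proof.
by rewrite /unbend /bend up_comp -compA cup_nat compA up_cap_cup comp1l.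
Qed.

Lemma bend_inj n m (a b : expr K n m.+1) : bend a === bend b -> a === b.
Proof. by move=> E; rewrite -(bendK a) -(bendK b) /unbend E. Qed.

End Deduction.

(** * Colourings determine diagrams *)

Lemma monochrome_set1 (T : finType) (B : {set T}) c :
  reflect {in B &, forall x y, c x = c y} (monochrome [set B] c).
Proof.
apply: (iffP (monochromeP _ _)) => [h x y xB yB|h C x y].
  by apply: (h B); rewrite ?inE.
by rewrite inE => /eqP ->; exact: h.
Qed.

(** Painting all nodes with one colour suits every diagram, and gives the
    equality of the exponents; the pairings then agree by [monochrome_inj]. *)
Lemma compatible_inj k l (D D' : brauer k l) N N' :
  (forall s t, size s = k -> size t = l ->
     2 ^ N * compatible D s t = 2 ^ N' * compatible D' s t) -> N = N' /\ D = D'.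
Proof.
move=> E; have EN : N = N'.
  have const (D0 : brauer k l) : compatible D0 (nseq k false) (nseq l false).
    apply/monochromeP => B x y _ _ _.
    by case: x; case: y => i j /=; rewrite !nth_nseq !if_same.
  have := E (nseq k false) (nseq l false) (size_nseq _ _) (size_nseq _ _).
  by rewrite !const !muln1 => /eqP; rewrite eqn_exp2l // => /eqP.
split=> //; apply: val_inj; apply: monochrome_inj; try exact: arcs_pairing.
move=> c; pose s := [tuple c (inl i) | i < k].
pose t := [tuple c (inr i) | i < l].
have cE : c =1 node_colour s t.
  by case=> i; symmetry; apply: etrans (esym (tnth_nth false _ i)) _;
    rewrite tnth_mktuple.
rewrite !(eq_monochrome _ cE).
have /eqP := E s t (size_tuple _) (size_tuple _).
rewrite EN eqn_pmul2l ?expn_gt0 // => /eqP.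
by rewrite /compatible /arcs; do 2 case: monochrome.
Qed.

Lemma compatible_dtens p q k l (D : brauer p q) (D' : brauer k l) s t :
  compatible (dtens D D') s t =
  compatible D (take p s) (take q t) && compatible D' (drop p s) (drop q t).
Proof.
rewrite /compatible /arcs /= monochromeU !monochrome_imset.
congr (_ && _); apply: eq_monochrome.
  by case=> i /=; rewrite nth_take.
by case=> i /=; rewrite nth_drop.
Qed.

Lemma compatible_diag0 s t : compatible diag0 s t.
Proof. by apply/monochromeP => B x; case: x => -[]. Qed.

Lemma compatible_diagI s t :
  compatible diagI s t = (nth false s 0 == nth false t 0).
Proof.
apply/monochrome_set1/eqP => [h|h]; first by apply: (h (inl ord0) (inr ord0)).
by case=> i [] j _ _; rewrite !ord1 /=.
Qed.

Lemma compatible_diagA s t :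
  compatible diagA s t = (nth false s 0 == nth false s 1).
Proof.
apply/monochrome_set1/eqP => [h|h].
  by apply: (h (inl ord0) (inl ord_max)).
by case=> -[[|[|i]] hi] // [] [[|[|j]] hj].
Qed.

Lemma compatible_diagU s t :
  compatible diagU s t = (nth false t 0 == nth false t 1).
Proof.
apply/monochrome_set1/eqP => [h|h].
  by apply: (h (inr ord0) (inr ord_max)).
by case=> -[[|[|i]] hi] // [] [[|[|j]] hj].
Qed.

Lemma compatible_diagX s t :
  compatible diagX s t = (nth false s 0 == nth false t 1) &&
                         (nth false s 1 == nth false t 0).
Proof.
rewrite /compatible /arcs /= /cross_arcs monochromeU.
congr (_ && _); apply/monochrome_set1/eqP => [h|h].
- by apply: (h (inl ord0) (inr ord_max)); rewrite !inE eqxx ?orbT.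
- by move=> x y /set2P[] -> /set2P[] ->.
- by apply: (h (inl ord_max) (inr ord0)); rewrite !inE eqxx ?orbT.
- by move=> x y /set2P[] -> /set2P[] ->.
Qed.

(** * Sums over bit strings *)

(** The sum over all bit strings of a given length, as a recursion, so that the
    defining relations can be checked by computation. *)
Fixpoint bitsum n (F : seq bool -> nat) : nat :=
  match n with
  | 0 => F [::]
  | m.+1 => bitsum m (fun s => F (true :: s)) +
            bitsum m (fun s => F (false :: s))
  end.

Lemma eq_bitsum n F G :
  (forall s, size s = n -> F s = G s) -> bitsum n F = bitsum n G.
Proof.
elim: n F G => [|n IH] F G E /=; first exact: E.
by congr (_ + _); apply: IH => s sn; apply: E; rewrite /= sn.
Qed.

Lemma bitsum_mull n F c : bitsum n (fun s => c * F s) = c * bitsum n F.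
Proof. by elim: n F => [|n IH] F //=; rewrite !IH mulnDr. Qed.

Lemma bitsum_mulr n F c : bitsum n (fun s => F s * c) = bitsum n F * c.
Proof. by elim: n F => [|n IH] F //=; rewrite !IH mulnDl. Qed.

Lemma bitsumD n F G : bitsum n (fun s => F s + G s) = bitsum n F + bitsum n G.
Proof. by elim: n F G => [|n IH] F G //=; rewrite !IH addnACA. Qed.

Lemma exchange_bitsum n m F :
  bitsum n (fun s => bitsum m (F s)) = bitsum m (fun t => bitsum n (F^~ t)).
Proof. by elim: n F => [|n IH] F //=; rewrite !IH -bitsumD. Qed.

Lemma bitsum_cat n m F :
  bitsum (n + m) F = bitsum n (fun s => bitsum m (fun t => F (s ++ t))).
Proof. by elim: n F => [|n IH] F //=; rewrite !IH. Qed.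

Lemma bitsum_rcons n F :
  bitsum n.+1 F =
  bitsum n (fun s => F (rcons s true)) + bitsum n (fun s => F (rcons s false)).
Proof.
elim: n F => [|n IH] F //.
transitivity (bitsum n.+1 (fun s => F (true :: s)) +
              bitsum n.+1 (fun s => F (false :: s))) => //.
by rewrite (IH (fun s => F (true :: s))) (IH (fun s => F (false :: s))) addnACA.
Qed.

Lemma bitsum_rev n F : bitsum n (fun s => F (rev s)) = bitsum n F.
Proof.
elim: n F => [|n IH] F //.
rewrite [RHS]bitsum_rcons -IH -(IH (fun s => F (rcons s _))) /=.
by congr (_ + _); apply: eq_bitsum => s _; rewrite rev_cons.
Qed.

Lemma bitsum_delta n F s : size s = n ->
  bitsum n (fun t => (s == t) * F t) = F s.
Proof.
elim: n F s => [|n IH] F [|b s] //= => [_|[sn]]; first by rewrite mul1n.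
have E c : bitsum n (fun t => ((b :: s) == (c :: t)) * F (c :: t)) =
           (b == c) * F (c :: s).
  rewrite -(IH (fun t => F (c :: t)) s sn) -bitsum_mull.
  by apply: eq_bitsum => t _; rewrite eqseq_cons -mulnb mulnA.
by rewrite !E; case: b {E}; rewrite !(mul0n, mul1n, addn0).
Qed.

Lemma bitsumE n F : bitsum n F = \sum_(s : n.-tuple bool) F s.
Proof.
elim: n F => [|n IH] F /=.
  rewrite (big_pred1 [tuple]) // => s.
  by apply/esym/eqP; rewrite [s]tuple0.
have E b : bitsum n (fun s => F (b :: s)) =
           \sum_(s : n.+1.-tuple bool | thead s == b) F s.
  rewrite IH (reindex (fun s : n.-tuple bool => [tuple of b :: s])) /=.
    by apply: eq_bigl => s; rewrite theadE eqxx.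
  exists (fun s : n.+1.-tuple bool => [tuple of behead s]) => s.
    by move=> _; apply: val_inj.
  by case/tupleP: s => c s; rewrite inE theadE => /eqP ->; apply: val_inj.
rewrite !E [RHS](bigID (fun s : n.+1.-tuple bool => thead s)) /=.
by congr (_ + _); apply: eq_bigl => s /=; case: (thead s).
Qed.

(** * The matrix of a word *)

Section Evaluation.

Variables (K : comPzRingType) (delta : K).
Local Open Scope ring_scope.

Local Notation bhom k l := {ffun brauer k l -> K^o}.
Local Notation ev := (eval delta).

(** The matrix of a word when each strand stands for a space with basis [bool],
    paired by the standard form: a representation of the category with parameter
    [2]. Only words matter, so [Zero], [Add] and [Scale] get a dummy value. *)
Fixpoint entry k l (a : expr K k l) (s t : seq bool) : nat :=
  (match a with
  | Empty => 1
  | GenI => nth false s 0 == nth false t 0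
  | GenX => (nth false s 0 == nth false t 1) && (nth false s 1 == nth false t 0)
  | GenA => nth false s 0 == nth false s 1
  | GenU => nth false t 0 == nth false t 1
  | Comp _ l _ a b => bitsum l (fun m => entry b s m * entry a m t)
  | Tens p q _ _ a b =>
      entry a (take p s) (take q t) * entry b (drop p s) (drop q t)
  | Zero _ _ | Add _ _ _ _ | Scale _ _ _ _ => 0
  end)%N.

Lemma basis_sum k l (f : bhom k l) : f = \sum_D f D *: basis K D.
Proof.
apply/ffunP => D; rewrite sum_ffunE (bigD1 D) // big1 => [|D' nD].
  by rewrite !ffunE eqxx [LHS](esym (mulr1 _)); exact: (esym (addr0 _)).
by rewrite !ffunE eq_sym (negPf nD); exact: mulr0.
Qed.

Lemma bscaleE k l c (f : bhom k l) D : (c *: f) D = c * f D.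
Proof. by rewrite ffunE. Qed.

Lemma bcompDl k l p (f f' : bhom l p) (g : bhom k l) :
  bcomp delta (f + f') g = bcomp delta f g + bcomp delta f' g.
Proof.
rewrite /bcomp -big_split; apply: eq_bigr => D1 _ /=.
by rewrite -big_split; apply: eq_bigr => D2 _ /=; rewrite ffunE mulrDl scalerDl.
Qed.

Lemma bcompDr k l p (f : bhom l p) (g g' : bhom k l) :
  bcomp delta f (g + g') = bcomp delta f g + bcomp delta f g'.
Proof.
rewrite /bcomp -big_split; apply: eq_bigr => D1 _ /=.
by rewrite -big_split; apply: eq_bigr => D2 _ /=; rewrite ffunE mulrDr scalerDl.
Qed.

Lemma bcompZl k l p c (f : bhom l p) (g : bhom k l) :
  bcomp delta (c *: f) g = c *: bcomp delta f g.
Proof.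
rewrite /bcomp scaler_sumr; apply: eq_bigr => D1 _ /=.
rewrite scaler_sumr; apply: eq_bigr => D2 _ /=.
by rewrite bscaleE [RHS]scalerA mulrA.
Qed.

Lemma bcompZr k l p c (f : bhom l p) (g : bhom k l) :
  bcomp delta f (c *: g) = c *: bcomp delta f g.
Proof.
rewrite /bcomp scaler_sumr; apply: eq_bigr => D1 _ /=.
rewrite scaler_sumr; apply: eq_bigr => D2 _ /=.
by rewrite bscaleE [RHS]scalerA mulrCA.
Qed.

Lemma btensDl p q k l (f f' : bhom p q) (g : bhom k l) :
  btens (f + f') g = btens f g + btens f' g.
Proof.
rewrite /btens -big_split; apply: eq_bigr => D1 _ /=.
by rewrite -big_split; apply: eq_bigr => D2 _ /=; rewrite ffunE mulrDl scalerDl.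
Qed.

Lemma btensDr p q k l (f : bhom p q) (g g' : bhom k l) :
  btens f (g + g') = btens f g + btens f g'.
Proof.
rewrite /btens -big_split; apply: eq_bigr => D1 _ /=.
by rewrite -big_split; apply: eq_bigr => D2 _ /=; rewrite ffunE mulrDr scalerDl.
Qed.

Lemma btensZl p q k l c (f : bhom p q) (g : bhom k l) :
  btens (c *: f) g = c *: btens f g.
Proof.
rewrite /btens scaler_sumr; apply: eq_bigr => D1 _ /=.
rewrite scaler_sumr; apply: eq_bigr => D2 _ /=.
by rewrite bscaleE [RHS]scalerA mulrA.
Qed.

Lemma btensZr p q k l c (f : bhom p q) (g : bhom k l) :
  btens f (c *: g) = c *: btens f g.
Proof.
rewrite /btens scaler_sumr; apply: eq_bigr => D1 _ /=.
rewrite scaler_sumr; apply: eq_bigr => D2 _ /=.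
by rewrite bscaleE [RHS]scalerA mulrCA.
Qed.

Lemma basisE k l (D D' : brauer k l) : basis K D D' = (D' == D)%:R.
Proof. by rewrite ffunE. Qed.

Lemma sum_basis k l p q (D0 : brauer k l) (F : brauer k l -> bhom p q) c :
  (\sum_(D : brauer k l) (basis K D0 D * c) *: F D) = c *: F D0.
Proof.
rewrite (bigD1 D0) // big1 => [|D nD].
  by rewrite basisE eqxx mul1r; exact: addr0.
by rewrite basisE (negPf nD) mul0r scale0r.
Qed.

Lemma bcomp_basis k l p (D1 : brauer l p) (D2 : brauer k l) :
  bcomp delta (basis K D1) (basis K D2) =
  delta ^+ loops D1 D2 *: basis K (dcomp D1 D2).
Proof.
rewrite /bcomp exchange_big.
under eq_bigr => D _ do rewrite sum_basis -[basis K D2 D]mulr1.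
by rewrite sum_basis scale1r.
Qed.

Lemma btens_basis p q k l (D : brauer p q) (D' : brauer k l) :
  btens (basis K D) (basis K D') = basis K (dtens D D').
Proof.
rewrite /btens exchange_big.
under eq_bigr => E _ do rewrite sum_basis -[basis K D' E]mulr1.
by rewrite sum_basis scale1r.
Qed.

(** A closed loop contributes a factor [delta] on one side and [2] on the other,
    so the same exponent appears in both. *)
Lemma eval_word k l (w : expr K k l) : is_word w ->
  exists N D, ev w = delta ^+ N *: basis K D /\
    forall s t, entry w s t = (2 ^ N * compatible D s t)%N.
Proof.
elim: k l / w => //.
- move=> _; exists 0, diag0; rewrite scale1r; split=> // s t.
  by rewrite compatible_diag0.
- move=> _; exists 0, diagI; rewrite scale1r; split=> // s t.
  by rewrite mul1n compatible_diagI.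
- move=> _; exists 0, diagX; rewrite scale1r; split=> // s t.
  by rewrite mul1n compatible_diagX.
- move=> _; exists 0, diagA; rewrite scale1r; split=> // s t.
  by rewrite mul1n compatible_diagA.
- move=> _; exists 0, diagU; rewrite scale1r; split=> // s t.
  by rewrite mul1n compatible_diagU.
- move=> k l p a IHa b IHb /= /andP[].
  move=> /IHa[N [D [Ea Sa]]] /IHb[N' [D' [Eb Sb]]].
  exists (N + N' + loops D D')%N, (dcomp D D'); split=> [|s t].
    by rewrite Ea Eb bcompZl bcompZr bcomp_basis !scalerA -!exprD.
  rewrite expnD -mulnA -compatible_dcomp.
  rewrite -(bitsumE _ (fun m => compatible D' s m * compatible D m t)%N).
  rewrite -bitsum_mull.
  by apply: eq_bitsum => m _; rewrite Sa Sb mulnACA -expnD (addnC N').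
- move=> p q k l a IHa b IHb /= /andP[].
  move=> /IHa[N [D [Ea Sa]]] /IHb[N' [D' [Eb Sb]]].
  exists (N + N')%N, (dtens D D'); split=> [|s t].
    by rewrite Ea Eb btensZl btensZr btens_basis scalerA -exprD.
  by rewrite Sa Sb expnD compatible_dtens mulnACA mulnb.
Qed.

(** The matrix of a word determines its exponent and its diagram, so equations
    between words can be tested on matrices, whatever [K] and [delta] are. *)
Lemma eval_eq_of_entry n k l (w w' : expr K k l) : is_word w -> is_word w' ->
  (forall s t, size s = k -> size t = l ->
     entry w s t = 2 ^ n * entry w' s t)%N ->
  ev w = delta ^+ n *: ev w'.
Proof.
move=> /eval_word[N [D [-> S]]] /eval_word[N' [D' [-> S']]] E.
have [->  ->] : N = (n + N')%N /\ D = D'.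
  apply: compatible_inj => s t sk tl.
  by rewrite -S E // S' expnD mulnA.
by rewrite scalerA exprD.
Qed.

End Evaluation.

(** * Matrices of normal forms *)

Section NormalFormEntries.

Variable K : comPzRingType.

(** If row [s] of [g] has a single nonzero entry, the sum over the middle row
    collapses. *)
Lemma entry_comp_det k l p (f : expr K l p) (g : expr K k l) s s' c t :
  size s' = l -> (forall m, size m = l -> entry g s m = c * (s' == m)) ->
  entry (Comp f g) s t = c * entry f s' t.
Proof.
move=> ss' E /=.
rewrite -(bitsum_delta (fun m => entry f m t) ss') -bitsum_mull.
by apply: eq_bitsum => m sm; rewrite E // mulnA.
Qed.

Lemma entry_ids n s t : size s = n -> size t = n ->
  entry (ids K n) s t = (s == t).
Proof.
elim: n s t => [|n IH] [|b s] [|c t] //= [sn] [tn].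
by rewrite !drop0 IH // mulnb eqseq_cons.
Qed.

Lemma entry_up n m (a : expr K n m) b s c t :
  entry (up a) (b :: s) (c :: t) = (b == c) * entry a s t.
Proof. by rewrite /= !drop0. Qed.

Lemma entry_cap n b c s t : size s = n -> size t = n ->
  entry (cap K n) (b :: c :: s) t = (b == c) * (s == t).
Proof. by move=> sn tn; rewrite /= !drop0 entry_ids. Qed.

Lemma entry_cup n s b c t : size s = n -> size t = n ->
  entry (cup K n) s (b :: c :: t) = (b == c) * (s == t).
Proof. by move=> sn tn; rewrite /= !drop0 entry_ids. Qed.

Lemma entry_swap n b c s t : size s = n -> size t = n.+2 ->
  entry (swap K n) (b :: c :: s) t = (c :: b :: s == t).
Proof.
case: t => [|x [|y t]] // sn [tn].
by rewrite /= !drop0 entry_ids // !eqseq_cons mulnb andbA (andbC (b == y)).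
Qed.

Definition remove_bit j (s : seq bool) := take j s ++ drop j.+1 s.

Lemma size_remove_bit j s : j < size s -> size (remove_bit j s) = (size s).-1.
Proof.
move=> js; rewrite size_cat size_drop size_takel; last exact: ltnW.
by case: s js => // b s js; rewrite subSS subnKC.
Qed.

Lemma entry_arch n j b s t : size s = n.+1 -> size t = n ->
  entry (arch K n j) (b :: s) t =
  (b == nth false s (minn j n)) * (remove_bit (minn j n) s == t).
Proof.
elim: n j b s t => [|n IH] j b s t.
  rewrite minn0; case: s => [|c s] // [sn] tn.
  by rewrite [arch _ _ _]/(cap K 0) entry_cap // /remove_bit /= drop0.
case: j => [|j].
  case: s => [|c s] // [sn] tn.
  by rewrite min0n entry_cap // /remove_bit /= drop0.
case: s => [|c s] // [sn]; case: t => [|d t] // [tn]; rewrite minnSS.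
have E m : size m = n.+3 -> entry (swap K n.+1) (b :: c :: s) m =
                            1 * (c :: b :: s == m).
  by move=> sm; rewrite mul1n entry_swap.
rewrite archS (entry_comp_det _ _ _ E) ?mul1n; last by rewrite /= sn.
rewrite entry_up IH //.
by rewrite mulnCA /remove_bit /= eqseq_cons mulnb.
Qed.

Lemma entry_comp_arch n j l (f : expr K n l) b s t : size s = n.+1 ->
  entry (Comp f (arch K n j)) (b :: s) t =
  (b == nth false s (minn j n)) * entry f (remove_bit (minn j n) s) t.
Proof.
move=> sn; have jn : minn j n < size s by rewrite sn ltnS geq_minr.
apply: entry_comp_det => [|m mn]; first by rewrite size_remove_bit // sn.
exact: entry_arch.
Qed.

Lemma entry_unbend n m (a : expr K n.+1 m) s b t : size s = n ->
  entry (unbend a) s (b :: t) = entry a (b :: s) t.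
Proof.
move=> sn; rewrite -[LHS]/(bitsum n.+2 (fun m => entry (cup K n) s m *
                                          entry (up a) m (b :: t))).
transitivity (bitsum n.+2 (fun m =>
    (b :: b :: s == m) * entry (up a) m (b :: t))).
  apply: eq_bitsum => -[|x [|y u]] // [un].
  rewrite entry_cup // entry_up !eqseq_cons (eq_sym b x).
  have [->|_] /= := eqVneq x b; first by rewrite mul1n mulnb.
  by rewrite !mul0n muln0.
rewrite (bitsum_delta (fun u => entry (up a) u (b :: t))).
  by rewrite entry_up eqxx mul1n.
by rewrite /= sn.
Qed.

Lemma arch_minn n j : arch K n (minn j n) = arch K n j.
Proof.
elim: n j => [|n IH] [|j] //.
by rewrite minnSS !archS IH.
Qed.

Lemma is_word_ids n : is_word (ids K n).
Proof. by elim: n. Qed.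

Lemma is_word_arch n j : is_word (arch K n j).
Proof.
elim: n j => [|n IH] [|j] //=; rewrite ?is_word_ids //.
by rewrite IH.
Qed.

Lemma is_word_nf n c : ~~ odd n -> is_word (nf K n c).
Proof.
elim/ltn_ind: n c => -[|[|n]] IH c //= nn.
by rewrite is_word_arch IH // -[odd n]negbK.
Qed.

Lemma entry_nf_const n c : ~~ odd n -> entry (nf K n c) (nseq n false) [::] = 1.
Proof.
elim/ltn_ind: n c => -[|[|n]] IH c // nn.
rewrite nfSS -[nseq _ _]/(false :: nseq n.+1 false).
rewrite entry_comp_arch ?size_nseq //.
rewrite nth_nseq if_same eqxx mul1n.
set j := minn _ _; have jn : j <= n by exact: geq_minr.
have -> : remove_bit j (nseq n.+1 false) = nseq n false.
  rewrite /remove_bit take_nseq ?drop_nseq; last exact: leqW.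
  by rewrite subSS -nseqD subnKC.
by apply: IH => //; move: nn => /=; rewrite negbK.
Qed.

(** Give the colour [true] to strand [0] and to the end of the first arch of one
    of the normal forms, and [false] to all other strands: the entry is nonzero
    only if the first arch of the other normal form has the same end. Then any
    colouring of the remaining strands extends to all, so that the rest is
    compared by induction. The conclusion is an equality of expressions because
    [arch] only depends on the truncated end. *)
Lemma nf_inj n c c' : ~~ odd n ->
  (forall s, size s = n ->
     entry (nf K n c) s [::] = entry (nf K n c') s [::]) ->
  nf K n c = nf K n c'.
Proof.
elim/ltn_ind: n c c' => -[|[|n]] IH c c' // nn E; rewrite /= negbK in nn.
rewrite !nfSS -(arch_minn n (head 0 c)) -(arch_minn n (head 0 c')).
have {E} E s b : size s = n.+1 ->
   (b == nth false s (minn (head 0 c) n)) *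
     entry (nf K n (behead c)) (remove_bit (minn (head 0 c) n) s) [::] =
   (b == nth false s (minn (head 0 c') n)) *
     entry (nf K n (behead c')) (remove_bit (minn (head 0 c') n) s) [::].
  move=> sn; have := E (b :: s).
  by rewrite !nfSS !entry_comp_arch //=; apply; rewrite sn.
have : minn (head 0 c) n <= n by exact: geq_minr.
have : minn (head 0 c') n <= n by exact: geq_minr.
move: (minn _ _) (minn _ _) E => j' j E j'n jn.
pose ins (s : seq bool) := take j s ++ true :: drop j s.
have size_ins s : size s = n -> size (ins s) = n.+1.
  by move=> sn; rewrite size_cat /= addnS -size_cat cat_take_drop sn.
have nth_ins s : size s = n -> nth false (ins s) j = true.
  by move=> sn; rewrite nth_cat size_takel ?sn // ltnn subnn.
have remove_ins s : size s = n -> remove_bit j (ins s) = s.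
  move=> sn; rewrite /remove_bit take_size_cat ?size_takel ?sn //.
  rewrite /ins -cat_rcons drop_size_cat ?cat_take_drop //.
  by rewrite size_rcons size_takel ?sn.
have jj' : j = j'.
  have sn := size_nseq n false.
  have := E _ true (size_ins _ sn); rewrite nth_ins // remove_ins //.
  rewrite entry_nf_const //; have [//|nj] := eqVneq j' j.
  suff -> : nth false (ins (nseq n false)) j' = false by [].
  rewrite nth_cat size_takel ?sn //; case: ltnP => jj.
    by rewrite nth_take // nth_nseq if_same.
  have {}jj : j < j' by rewrite ltn_neqAle eq_sym nj.
  by rewrite -(subnSK jj) /= nth_drop nth_nseq if_same.
rewrite -jj' in E *; congr Comp; apply: IH => // s sn.
by have := E _ true (size_ins _ sn); rewrite nth_ins // remove_ins // !mul1n.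
Qed.

End NormalFormEntries.

(** * Diagrams as values of words *)

Section LabelledColourings.

Variable L : eqType.
Implicit Types (z : seq (L * bool)) (r t : seq L) (s u : seq bool).

(** A pairing is presented here by labels on the nodes, two nodes being joined
    when their labels are equal. Nodes can then be moved or removed without
    renumbering the others. *)
Definition agrees z : bool :=
  all (fun p => all (fun q => (p.1 == q.1) ==> (p.2 == q.2)) z) z.

Lemma agreesP z :
  reflect {in z &, forall p q, p.1 = q.1 -> p.2 = q.2} (agrees z).
Proof.
apply: (iffP allP) => [h p q pz qz /eqP E|h p pz].
  by move/allP: (h p pz) => /(_ q qz); rewrite E => /eqP.
by apply/allP => q qz; apply/implyP => /eqP/(h p q pz qz) ->.
Qed.

Lemma eq_mem_agrees z z' : z =i z' -> agrees z = agrees z'.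
Proof.
by move=> E; apply/agreesP/agreesP => h p q pz qz; apply: h; rewrite ?E // -E.
Qed.

Lemma agrees_pair x b c z : x \notin [seq p.1 | p <- z] ->
  agrees ((x, b) :: (x, c) :: z) = (b == c) && agrees z.
Proof.
move=> xz; have nx p : p \in z -> p.1 = x -> False.
  by move=> pz E; case/negP: xz; rewrite -E; exact: map_f.
apply/agreesP/andP => [h|[/eqP -> /agreesP h] p q].
  split; first by apply/eqP/(h (x, b) (x, c)); rewrite ?inE ?eqxx ?orbT.
  by apply/agreesP => p q pz qz; apply: h; rewrite !inE ?pz ?qz !orbT.
rewrite !inE => /or3P[/eqP->|/eqP->|pz] /or3P[/eqP->|/eqP->|qz] //= E.
- by case: (nx q).
- by case: (nx q).
- by case: (nx p).
- by case: (nx p).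
- exact: h.
Qed.

Variable K : comPzRingType.

(** The first node and its partner are joined by an arch and removed. *)
Lemma word_of_lower_labels n r : size r = n ->
  {in r, forall x, count_mem x r = 2} ->
  exists w : expr K n 0, is_word w /\
    forall s, size s = n -> entry w s [::] = agrees (zip r s).
Proof.
elim/ltn_ind: n r => -[|[|n]] IH [|x r] // rn cr.
- by exists (Empty K); split=> // -[].
- have := cr x (mem_head _ _); case: r rn {cr} => //= _.
  by rewrite eqxx.
case: rn => rn.
have xr : x \in r.
  by rewrite -has_pred1 has_count; have := cr x (mem_head _ _);
    rewrite /= eqxx add1n => -[->].
case/splitPr: xr rn cr => r1 r2 rn cr.
have [x1 x2] : x \notin r1 /\ x \notin r2.
  have := cr x (mem_head _ _); rewrite /= count_cat /= !eqxx.
  rewrite [X in _ + X]addnCA !add1n => -[/eqP].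
  by rewrite addn_eq0 !eqn0Ngt -!has_count !has_pred1 => /andP[].
have rn' : size (r1 ++ r2) = n.
  by move: rn; rewrite !size_cat /= addnS => -[].
have [//||v [wv sv]] := IH n _ (r1 ++ r2) rn'.
  move=> y yr; have yx : (x == y) = false.
    by apply/eqP => E; move: yr; rewrite -E mem_cat (negPf x1) (negPf x2).
  have /cr : y \in x :: r1 ++ x :: r2.
    by move: yr; rewrite !(inE, mem_cat) => /orP[] ->; rewrite !orbT.
  by rewrite /= !count_cat /= yx.
exists (Comp v (arch K n (size r1))); split=> /=.
  by rewrite wv is_word_arch.
case=> [|b s] // [sn].
have jn : size r1 <= n by rewrite -rn' size_cat leq_addr.
rewrite -[LHS]/(entry (Comp v (arch K n (size r1))) (b :: s) [::]).
rewrite entry_comp_arch // (minn_idPl jn) sv; last first.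
  by rewrite size_remove_bit sn.
set j := size r1; set c := nth false s j.
have es : s = take j s ++ c :: drop j.+1 s.
  by rewrite -drop_nth ?cat_take_drop // sn ltnS.
have sj : size r1 = size (take j s) by rewrite size_takel // sn leqW.
rewrite mulnb; congr (nat_of_bool _); rewrite {2}es /= !zip_cat //=.
have s2 : size r2 = size (drop j.+1 s).
  by rewrite size_drop sn -rn' size_cat subSS addKn.
rewrite -(@agrees_pair x).
  apply: eq_mem_agrees => p; rewrite !(inE, mem_cat).
  by congr (_ || _); rewrite orbCA.
rewrite map_cat mem_cat negb_or -!/(unzip1 _) !unzip1_zip ?x1 //.
  by rewrite -s2.
by rewrite -sj.
Qed.

(** The upper nodes are bent down one at a time. *)
Lemma word_of_labels k l r t : size r = k -> size t = l ->
  {in r ++ t, forall x, count_mem x (r ++ t) = 2} ->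
  exists w : expr K k l, is_word w /\
    forall s u, size s = k -> size u = l ->
      entry w s u = agrees (zip r s ++ zip t u).
Proof.
elim: l k r t => [|l IH] k r [|x t] // rk.
  move=> _; rewrite cats0 => /(word_of_lower_labels rk)[w [ww sw]].
  by exists w; split=> // s [|//] sk _; rewrite sw // cats0.
move=> [tl] c; have [//|//||v [wv sv]] := IH k.+1 (x :: r) t.
- by rewrite /= rk.
- have P : perm_eq ((x :: r) ++ t) (r ++ x :: t).
    by rewrite -cat_rcons perm_cat2r perm_sym perm_rcons.
  move=> y; rewrite (perm_mem P) => /c <-; exact: (seq.permP P).
exists (unbend v); split=> [|s [|b u] // sk [ul]].
  by rewrite /= wv is_word_ids.
rewrite entry_unbend // sv //= ?sk //; congr (nat_of_bool _).
by apply: eq_mem_agrees => p; rewrite !(inE, mem_cat) orbCA.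
Qed.

End LabelledColourings.

Section Generation.

Variables (K : comPzRingType) (delta : K).

(** The label of a node is the arc that contains it. *)
Lemma word_of_diagram k l (D : brauer k l) :
  exists w : expr K k l, is_word w /\ eval delta w = basis K D.
Proof.
pose lab := pblock (arcs D).
pose r := [seq lab (inl i) | i <- enum 'I_k].
pose t := [seq lab (inr i) | i <- enum 'I_l].
pose nodes : seq (node k l) := map inl (enum 'I_k) ++ map inr (enum 'I_l).
have nodesE : perm_eq nodes (enum (node k l)).
  apply: uniq_perm; rewrite ?enum_uniq //.
    have injl : injective (@inl 'I_k 'I_l) by move=> ? ? [].
    have injr : injective (@inr 'I_k 'I_l) by move=> ? ? [].
    rewrite cat_uniq (map_inj_uniq injl) (map_inj_uniq injr) !enum_uniq andbT.
    apply/hasPn => _ /mapP[i _ ->].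
    by apply/negP => /mapP[].
  move=> x; rewrite mem_enum inE mem_cat; case: x => i.
    by rewrite map_f ?mem_enum.
  by rewrite orbC map_f ?mem_enum.
have rt : r ++ t = map lab nodes.
  by rewrite /nodes map_cat; congr (_ ++ _); exact: map_comp.
have /and3P[/eqP cP tP _] : partition (arcs D) [set: node k l].
  by case/andP: (arcs_pairing D).
have inP x : x \in cover (arcs D) by rewrite cP inE.
have [|||w [ww sw]] := @word_of_labels _ K k l r t.
- by rewrite size_map size_enum_ord.
- by rewrite size_map size_enum_ord.
- rewrite rt => _ /mapP[x _ ->]; rewrite count_map.
  rewrite (seq.permP nodesE) -size_filter.
  rewrite -(pairing_card (arcs_pairing D) (pblock_mem (inP x))) cardE.
  apply/perm_size/uniq_perm; rewrite ?filter_uniq -?enumT ?enum_uniq //.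
  move=> y; rewrite mem_filter -?enumT !mem_enum andbT /=.
  by rewrite eq_sym eq_pblock.
have [N [D' [Ew Sw]]] := eval_word delta ww.
exists w; split=> //; rewrite Ew.
have [-> ->] : N = 0 /\ D' = D; last by rewrite scale1r.
apply: compatible_inj => s u sk ul; rewrite -Sw sw // mul1n.
congr (nat_of_bool _).
have -> : zip r s ++ zip t u = [seq (lab x, node_colour s u x) | x <- nodes].
  have zipE n (f : 'I_n -> {set node k l}) (v : seq bool) : size v = n ->
      zip [seq f i | i <- enum 'I_n] v =
      [seq (f i, nth false v i) | i <- enum 'I_n].
    move=> vn; rewrite -[in LHS](mkseq_nth false v) vn.
    by rewrite /mkseq -val_enum_ord -map_comp zip_map.
  rewrite (zipE _ (fun i => lab (inl i)) _ sk).
  rewrite (zipE _ (fun i => lab (inr i)) _ ul) /nodes map_cat.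
  by congr (_ ++ _); exact: map_comp.
apply/agreesP/monochromeP => [h B x y BD xB yB|h p q].
  have inN z : z \in nodes by rewrite (perm_mem nodesE) mem_enum.
  apply: (h (lab x, _) (lab y, _)); rewrite ?map_f //.
  by rewrite /lab /= !(def_pblock tP BD).
case/mapP=> x _ -> /mapP[y _ ->] /= E.
apply: (h (lab x)); rewrite ?pblock_mem // ?mem_pblock //.
by rewrite E mem_pblock.
Qed.

End Generation.

(** * Soundness of deductions *)

Section Soundness.

Variables (K : comPzRingType) (delta : K).
Local Open Scope ring_scope.

Local Notation bhom k l := {ffun brauer k l -> K^o}.
Local Notation ev := (eval delta).

(** Diagrams form a basis and are values of words, so identities linear in a
    morphism need only be checked on words. *)
Lemma linear_eq k l (V : lmodType K) (F G : bhom k l -> V) :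
  linear F -> linear G ->
  (forall w : expr K k l, is_word w -> F (ev w) = G (ev w)) -> F =1 G.
Proof.
move=> lF lG E f; rewrite (basis_sum f).
have lin0 (H : bhom k l -> V) : linear H -> H 0 = 0.
  move=> lH; apply: (addrI (H 0)).
  rewrite addr0 -[in X in X + _](scale1r (H 0)).
  by rewrite -lH scaler0 addr0.
elim: (index_enum _) => [|D s IH]; first by rewrite !big_nil !lin0.
rewrite !big_cons lF lG IH; congr (_ *: _ + _).
by have [w [ww <-]] := word_of_diagram delta D; exact: E.
Qed.

Definition bcast k l k' l' (ek : k = k') (el : l = l') (f : bhom k l) :
    bhom k' l' :=
  ecast k0 (bhom k0 l') ek (ecast l0 (bhom k l0) el f).

Lemma bcastD k l k' l' (ek : k = k') (el : l = l') (f g : bhom k l) :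
  bcast ek el (f + g) = bcast ek el f + bcast ek el g.
Proof. by case: k' / ek; case: l' / el. Qed.

Lemma bcastZ k l k' l' (ek : k = k') (el : l = l') c (f : bhom k l) :
  bcast ek el (c *: f) = c *: bcast ek el f.
Proof. by case: k' / ek; case: l' / el. Qed.

Definition bilinE :=
  (bcompDl, bcompDr, bcompZl, bcompZr, btensDl, btensDr, btensZl, btensZr,
   bcastD, bcastZ).

Lemma eval_cast k l k' l' (ek : k = k') (el : l = l') (a : expr K k l) :
  ev (cast_expr ek el a) = bcast ek el (ev a).
Proof. by case: k' / ek; case: l' / el. Qed.

Lemma entry_cast k l k' l' (ek : k = k') (el : l = l') (a : expr K k l) :
  entry (cast_expr ek el a) = entry a.
Proof. by case: k' / ek; case: l' / el. Qed.

Lemma is_word_cast k l k' l' (ek : k = k') (el : l = l') (a : expr K k l) :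
  is_word (cast_expr ek el a) = is_word a.
Proof. by case: k' / ek; case: l' / el. Qed.

Lemma eval_eq_words k l (w w' : expr K k l) : is_word w -> is_word w' ->
  (forall s t, size s = k -> size t = l -> entry w s t = entry w' s t) ->
  ev w = ev w'.
Proof.
move=> ww ww' E; rewrite -[RHS]scale1r -(expr0 delta).
by apply: eval_eq_of_entry => // s t sk tl; rewrite mul1n E.
Qed.

Lemma entry_compA k l p q (a : expr K p q) (b : expr K l p) (c : expr K k l)
    s t :
  entry (Comp a (Comp b c)) s t = entry (Comp (Comp a b) c) s t.
Proof.
rewrite /=; transitivity (bitsum p (fun m => bitsum l (fun m' =>
    entry c s m' * entry b m' m * entry a m t)))%N.
  by apply: eq_bitsum => m _; rewrite bitsum_mulr.
rewrite exchange_bitsum; apply: eq_bitsum => m _; rewrite -bitsum_mull.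
by apply: eq_bitsum => m' _; rewrite mulnA.
Qed.

Lemma entry_tensA k l p q m n (a : expr K k l) (b : expr K p q)
    (c : expr K m n) s t :
  entry (Tens a (Tens b c)) s t = entry (Tens (Tens a b) c) s t.
Proof.
rewrite /= mulnA !take_takel ?leq_addr //.
by rewrite !take_drop !drop_drop !(addnC p) !(addnC q).
Qed.

Lemma entry_interchange k1 l1 p1 k2 l2 p2
    (a1 : expr K l1 p1) (a2 : expr K l2 p2)
    (b1 : expr K k1 l1) (b2 : expr K k2 l2) s t :
  entry (Comp (Tens a1 a2) (Tens b1 b2)) s t =
  entry (Tens (Comp a1 b1) (Comp a2 b2)) s t.
Proof.
rewrite /= bitsum_cat -bitsum_mulr; apply: eq_bitsum => x sx.
rewrite -bitsum_mull; apply: eq_bitsum => y _.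
by rewrite take_size_cat // drop_size_cat // mulnACA.
Qed.

Lemma bcompA k l p q (f : bhom p q) (g : bhom l p) (h : bhom k l) :
  bcomp delta f (bcomp delta g h) = bcomp delta (bcomp delta f g) h.
Proof.
move: f; apply: linear_eq => [c ? ?|c ? ?|a wa]; rewrite ?bilinE //.
move: g; apply: linear_eq => [c ? ?|c ? ?|b wb]; rewrite ?bilinE //.
move: h; apply: linear_eq => [c ? ?|c ? ?|d wd]; rewrite ?bilinE //.
apply: (@eval_eq_words _ _ (Comp a (Comp b d)) (Comp (Comp a b) d));
  rewrite /= ?wa ?wb // => s t _ _; exact: entry_compA.
Qed.

(** The two sides have different types, since addition is associative only up to
    a propositional equality. *)
Lemma btensA k l p q m n (f : bhom k l) (g : bhom p q) (h : bhom m n) :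
  bcast (addnA k p m) (addnA l q n) (btens f (btens g h)) =
  btens (btens f g) h.
Proof.
move: f; apply: linear_eq => [c ? ?|c ? ?|a wa]; rewrite ?bilinE //.
move: g; apply: linear_eq => [c ? ?|c ? ?|b wb]; rewrite ?bilinE //.
move: h; apply: linear_eq => [c ? ?|c ? ?|d wd]; rewrite ?bilinE //.
rewrite -[btens _ _ in LHS]/(ev (Tens a (Tens b d))) -eval_cast.
apply: (eval_eq_words (w' := Tens (Tens a b) d));
  rewrite ?is_word_cast /= ?wa ?wb // => s t _ _.
by rewrite entry_cast; exact: entry_tensA.
Qed.

Lemma binterchange k1 l1 p1 k2 l2 p2 (f1 : bhom l1 p1) (f2 : bhom l2 p2)
    (g1 : bhom k1 l1) (g2 : bhom k2 l2) :
  bcomp delta (btens f1 f2) (btens g1 g2) =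
  btens (bcomp delta f1 g1) (bcomp delta f2 g2).
Proof.
move: f1; apply: linear_eq => [c ? ?|c ? ?|a1 wa1]; rewrite ?bilinE //.
move: f2; apply: linear_eq => [c ? ?|c ? ?|a2 wa2]; rewrite ?bilinE //.
move: g1; apply: linear_eq => [c ? ?|c ? ?|b1 wb1]; rewrite ?bilinE //.
move: g2; apply: linear_eq => [c ? ?|c ? ?|b2 wb2]; rewrite ?bilinE //.
apply: (@eval_eq_words _ _ (Comp (Tens a1 a2) (Tens b1 b2))
                           (Tens (Comp a1 b1) (Comp a2 b2)));
  rewrite /= ?wa1 ?wa2 ?wb1 // => s t _ _; exact: entry_interchange.
Qed.

Lemma btens0l k l (f : bhom k l) : btens (ev (Empty K)) f = f.
Proof.
move: f; apply: linear_eq => [c ? ?|//|w ww]; rewrite ?bilinE //.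
apply: (@eval_eq_words _ _ (Tens (Empty K) w) w) => // s t _ _.
by rewrite /= !drop0 mul1n.
Qed.

Lemma btens0r k l (f : bhom k l) :
  bcast (addn0 k) (addn0 l) (btens f (ev (Empty K))) = f.
Proof.
move: f; apply: linear_eq => [c ? ?|//|w ww]; rewrite ?bilinE //.
rewrite -[btens _ _]/(ev (Tens w (Empty K))) -eval_cast.
apply: eval_eq_words; rewrite ?is_word_cast /= ?ww // => s t sk tl.
by rewrite entry_cast /= muln1 !take_oversize ?sk ?tl.
Qed.

Lemma bcomp0l k (f : bhom k 0) : bcomp delta (ev (Empty K)) f = f.
Proof.
move: f; apply: linear_eq => [c ? ?|//|w ww]; rewrite ?bilinE //.
apply: (@eval_eq_words _ _ (Comp (Empty K) w) w) => // s [] // _ _.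
by rewrite /= muln1.
Qed.

Lemma bcomp0r l (f : bhom 0 l) : bcomp delta f (ev (Empty K)) = f.
Proof.
move: f; apply: linear_eq => [c ? ?|//|w ww]; rewrite ?bilinE //.
apply: (@eval_eq_words _ _ (Comp w (Empty K)) w); rewrite /= ?ww //.
by move=> [] // t _ _; rewrite mul1n.
Qed.

(** Reflection in a horizontal line transposes the matrix. *)
Lemma entry_star k l (w : expr K k l) s t : is_word w ->
  entry (star w) t s = entry w s t.
Proof.
elim: k l / w s t => //=.
- by move=> s t _; rewrite eq_sym.
- move=> s t _; rewrite andbC; congr (nat_of_bool _).
  by rewrite eq_sym (eq_sym (nth false t 0)) andbC.
- move=> k l p a IHa b IHb s t /andP[wa wb]; apply: eq_bitsum => m _.
  by rewrite IHa // IHb // mulnC.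
- by move=> p q k l a IHa b IHb s t /andP[wa wb]; rewrite IHa // IHb.
Qed.

Lemma is_word_star k l (w : expr K k l) : is_word (star w) = is_word w.
Proof.
elim: k l / w => //= [k l p a -> b ->|p q k l a -> b -> //].
exact: andbC.
Qed.

Lemma is_word_sharp k l (w : expr K k l) : is_word (sharp w) = is_word w.
Proof.
elim: k l / w => //= [k l p a -> b -> //|p q k l a IHa b IHb].
by rewrite is_word_cast /= IHa IHb andbC.
Qed.

(** Reflection in a vertical line reads each row of nodes backwards. *)
Lemma entry_sharp k l (w : expr K k l) s t :
  is_word w -> size s = k -> size t = l ->
  entry (sharp w) s t = entry w (rev s) (rev t).
Proof.
elim: k l / w s t => //=.
- by move=> [|b []] // [|c []].
- move=> [|b [|c []]] // [|d [|e []]] // _ _ _.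
  by rewrite /rev /= andbC.
- by move=> [|b [|c []]] // t _ _ _; rewrite /rev /= eq_sym.
- by move=> s [|b [|c []]] // _ _ _; rewrite /rev /= eq_sym.
- move=> k l p a IHa b IHb s t /andP[wa wb] sk tp.
  rewrite -[RHS]bitsum_rev; apply: eq_bitsum => m ml.
  by rewrite IHa // IHb.
- move=> p q k l a IHa b IHb s t /andP[wa wb] sk tl.
  rewrite entry_cast /= IHa ?IHb ?size_drop ?sk ?tl ?addnK //;
    try by rewrite size_takel // ?sk ?tl leq_addl.
  by rewrite !take_rev !drop_rev sk tl !addKn mulnC.
Qed.

(** Both reflections preserve this form of a relation, in which a power of
    [delta] is split off the right-hand side and matched by a power of [2]. The
    relations from which they start are checked on all colourings. *)
Lemma entry_relation k l (a b : expr K k l) : defining_relation delta a b ->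
  is_word a /\ exists n b0, [/\ b = iter n (Scale delta) b0, is_word b0 &
    forall s t, size s = k -> size t = l ->
      (entry a s t = 2 ^ n * entry b0 s t)%N].
Proof.
elim=> {k l a b}; last 2 first.
- move=> k l a b _ [wa [n [b0 [-> wb0 E]]]]; rewrite is_word_star; split=> //.
  exists n, (star b0); rewrite is_word_star; split=> // [|s t sl tk].
    by elim: n {E} => //= n ->.
  by rewrite !entry_star // E.
- move=> k l a b _ [wa [n [b0 [-> wb0 E]]]]; rewrite is_word_sharp; split=> //.
  exists n, (sharp b0); rewrite is_word_sharp; split=> // [|s t sl tk].
    by elim: n {E} => //= n ->.
  by rewrite !entry_sharp // E ?size_rev.
all: split=> //.
(* [rel_AU] is the only one whose right-hand side is not a word. *)
8: by exists 1%N, (Empty K); split=> // -[] // [].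
all: exists 0%N; eexists; split; [reflexivity | by [] | ].
- by case=> [|b []] // [|c []] // _ _; case: b; case: c.
- by case=> [|b [|c []]] // [|d [|e []]] // _ _;
    case: b; case: c; case: d; case: e.
- by case=> [|b [|c []]] // [] // _ _; case: b; case: c.
- by case=> // -[|b [|c []]] // _ _; case: b; case: c.
- by case=> [|b [|c []]] // [|d [|e []]] // _ _;
    case: b; case: c; case: d; case: e.
- by case=> [|b [|c [|d []]]] // [|e [|f [|g []]]] // _ _;
    case: b; case: c; case: d; case: e; case: f; case: g.
- by case=> [|b [|c []]] // [] // _ _; case: b; case: c.
- by case=> [|b [|c [|d []]]] // [|e []] // _ _;
    case: b; case: c; case: d; case: e.
- by case=> [|b []] // [|c []] // _ _; case: b; case: c.
Qed.

Lemma eval_relation k l (a b : expr K k l) :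
  defining_relation delta a b -> ev a = ev b.
Proof.
case/entry_relation=> wa [n [b0 [-> wb0 E]]].
rewrite (eval_eq_of_entry _ wa wb0 E).
by elim: n {E} => [|n IH] /=; rewrite ?scale1r // -IH exprS scalerA.
Qed.

(** Equality of morphisms whose types are only propositionally equal. *)
Inductive same k l (f : bhom k l) : forall k' l', bhom k' l' -> Prop :=
  same_refl : same f f.

Lemma same_cast k l k' l' (ek : k = k') (el : l = l') (f : bhom k l) f' :
  bcast ek el f = f' -> same f f'.
Proof. by case: k' / ek f'; case: l' / el => f' /= <-. Qed.

Lemma same_eq k l (f f' : bhom k l) : same f f' -> f = f'.
Proof.
suff E k' l' (g : bhom k' l') : same f g ->
    forall (ek : k = k') (el : l = l'), bcast ek el f = g.
  by move=> s; rewrite -(E _ _ _ s (erefl k) (erefl l)).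
by case=> ek el; rewrite (eq_irrelevance ek erefl) (eq_irrelevance el erefl).
Qed.

Lemma same_sym k l (f : bhom k l) k' l' (f' : bhom k' l') :
  same f f' -> same f' f.
Proof. by case. Qed.

Lemma same_trans k l (f : bhom k l) k' l' (f' : bhom k' l')
    k'' l'' (f'' : bhom k'' l'') : same f f' -> same f' f'' -> same f f''.
Proof. by case. Qed.

Lemma same_of_eq k l (f f' : bhom k l) : f = f' -> same f f'.
Proof. by move=> ->. Qed.

Lemma same_type k l (f : bhom k l) k' l' (f' : bhom k' l') :
  same f f' -> k = k' /\ l = l'.
Proof. by case. Qed.

Lemma same_tens p q k l p' q' k' l' (f : bhom p q) (g : bhom k l)
    (f' : bhom p' q') (g' : bhom k' l') :
  same f f' -> same g g' -> same (btens f g) (btens f' g').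
Proof. by case; case. Qed.

Lemma same_scale k l c (f : bhom k l) k' l' (f' : bhom k' l') :
  same f f' -> same (c *: f) (c *: f').
Proof. by case. Qed.

Lemma eval_deducible k l (a : expr K k l) k' l' (a' : expr K k' l') :
  deducible delta a a' -> same (ev a) (ev a').
Proof.
elim=> {k l a k' l' a'} /=.
- by move=> k l a b /eval_relation /same_of_eq.
- by [].
- by move=> k l a k' l' a' _; exact: same_sym.
- by move=> k l a k' l' a' k'' l'' a'' _ S _; exact: same_trans.
- move=> k l p a b k' l' p' a' b' _ Sa _ Sb.
  have [el ep] := same_type Sa; have [ek _] := same_type Sb.
  case: k' / ek b' Sb; case: l' / el a' Sa => a'; case: p' / ep a' => a'.
  by move=> /same_eq -> b' /same_eq ->.
- by move=> p q k l a b p' q' k' l' a' b' _ Sa _ Sb; exact: same_tens.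
- move=> k l a b k' l' a' b' _ Sa _ Sb; have [ek el] := same_type Sa.
  case: k' / ek a' b' Sa Sb; case: l' / el => a' b'.
  by move=> /same_eq -> /same_eq ->.
- by move=> k l c a k' l' a' _; exact: same_scale.
- by move=> *; rewrite bcompA.
- by move=> k l p q r s a b c; apply: same_cast (btensA _ _ _).
- by move=> k l a; apply/same_of_eq/btens0l.
- by move=> k l a; apply: same_cast (btens0r _).
- by move=> k a; apply/same_of_eq/bcomp0l.
- by move=> k a; apply/same_of_eq/bcomp0r.
- by move=> *; rewrite binterchange.
- by move=> *; rewrite addrA.
- by move=> *; rewrite addrC.
- by move=> *; rewrite add0r.
- by move=> *; rewrite scalerA.
- by move=> *; rewrite scale1r.
- by move=> *; rewrite scale0r.
- by move=> *; rewrite scalerDr.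
- by move=> *; rewrite scalerDl.
all: by move=> *; rewrite bilinE.
Qed.

(** * Completeness of the relations *)

Lemma eval_ded k l (a b : expr K k l) : ded delta a b -> ev a = ev b.
Proof. by move/eval_deducible/same_eq. Qed.

Lemma is_word_parity k l (w : expr K k l) : is_word w -> odd k = odd l.
Proof.
elim: k l / w => //= [k l p a IHa b IHb|p q k l a IHa b IHb] /andP[wa wb].
  by rewrite IHb // IHa.
by rewrite !oddD IHa // IHb.
Qed.

(** No loop arises in a normal form: its entry at the constant colouring is [1],
    not a larger power of [2]. *)
Lemma eval_nf n c : ~~ odd n ->
  exists D, ev (nf K n c) = basis K D /\
    forall s, entry (nf K n c) s [::] = compatible D s [::].
Proof.
move=> nn; have [N [D [E S]]] := eval_word delta (is_word_nf K c nn).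
have N0 : N = 0%N.
  have := entry_nf_const K c nn; rewrite S; case: N {E S} => // N.
  by rewrite expnS -mulnA mul2n => /(congr1 odd); rewrite odd_double.
by exists D; rewrite E N0 scale1r; split=> // s; rewrite S N0 mul1n.
Qed.

Lemma scaled_basis_coef k l c d (D1 D2 : brauer k l) :
  c *: basis K D1 = d *: basis K D2 ->
  forall D, c * (D == D1)%:R = d * (D == D2)%:R.
Proof.
move=> E D; have <- : (c *: basis K D1) D = c * (D == D1)%:R.
  by rewrite bscaleE basisE.
by rewrite E bscaleE basisE.
Qed.

(** If the two normal forms represent different diagrams, then comparing
    coefficients shows that both powers of [delta] vanish in [K], and both
    words are deducibly zero. *)
Lemma deducible_of_eval0 n (w1 w2 : expr K n 0) : is_word w1 -> is_word w2 ->
  ev w1 = ev w2 -> ded delta w1 w2.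
Proof.
move=> ww1 ww2; have nn : ~~ odd n by rewrite (is_word_parity ww1).
have [N1 [c1 E1]] := word_nf delta ww1; have [N2 [c2 E2]] := word_nf delta ww2.
have [D1 [e1 S1]] := eval_nf c1 nn; have [D2 [e2 S2]] := eval_nf c2 nn.
rewrite (eval_ded E1) (eval_ded E2) /= e1 e2 => E.
apply: ded_trans E1 (ded_trans _ (ded_sym E2)).
have coef := scaled_basis_coef E.
have := coef D1; have := coef D2; rewrite !eqxx => EN2 EN1.
have [D12|nD] := eqVneq D1 D2.
  rewrite D12 eqxx !mulr1 in EN1; rewrite EN1.
  have -> : nf K n c1 = nf K n c2.
    by apply: (nf_inj nn) => s _; rewrite S1 S2 D12.
  exact: ded_refl.
rewrite (negPf nD) mulr0 mulr1 in EN1.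
rewrite eq_sym (negPf nD) mulr0 mulr1 in EN2.
rewrite EN1 -EN2; apply: ded_trans (ded_scale0 _ _) (ded_sym _).
exact: ded_scale0.
Qed.

(** The upper nodes are bent down, which leaves words to [0]. *)
Lemma deducible_of_eval k l (w1 w2 : expr K k l) : is_word w1 -> is_word w2 ->
  ev w1 = ev w2 -> ded delta w1 w2.
Proof.
elim: l k w1 w2 => [|l IH] k w1 w2; first exact: deducible_of_eval0.
move=> ww1 ww2 E; apply: bend_inj; apply: IH => /=.
- by rewrite is_word_ids.
- by rewrite is_word_ids.
- by rewrite E.
Qed.

End Soundness.

Lemma imset_setT_bij (T T' : finType) (f : T -> T') : bijective f ->
  [set f @: B | B : {set T} in [set [set: T]]] = [set [set: T']].
Proof.
case=> g _ gK; rewrite imset_set1; congr [set _]; apply/setP => y.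
by rewrite inE; apply/imsetP; exists (g y); rewrite ?inE ?gK.
Qed.

Lemma dsharp_diagX : dsharp diagX = diagX.
Proof.
apply: val_inj; rewrite /= /cross_arcs imsetU1 imset_set1 !imsetU1 !imset_set1.
rewrite setUC.
have r0 : rev_ord (ord0 : 'I_2) = ord_max by apply: val_inj.
have r1 : rev_ord (ord_max : 'I_2) = ord0 by apply: val_inj.
by rewrite /= r0 r1.
Qed.

Lemma dstar_diagX : dstar diagX = diagX.
Proof.
apply: val_inj; rewrite /= /cross_arcs imsetU1 imset_set1 !imsetU1 !imset_set1.
rewrite setUC.
by congr (_ |: [set _]); rewrite setUC.
Qed.

Theorem theorem2p6 (K : comPzRingType) (delta : K) :
  ((forall (k l : nat) (D : brauer k l),
      exists w : expr K k l, is_word w /\ eval delta w = basis K D) /\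
   [/\ dsharp diagI = diagI, dsharp diagX = diagX,
       dsharp diagA = diagA & dsharp diagU = diagU] /\
   [/\ dstar diagI = diagI, dstar diagX = diagX,
       dstar diagA = diagU & dstar diagU = diagA]) /\
  ((forall (k l : nat) (a b : expr K k l),
      defining_relation delta a b -> eval delta a = eval delta b) /\
   (forall (k l : nat) (w1 w2 : expr K k l),
      is_word w1 -> is_word w2 ->
      (eval delta w1 = eval delta w2 <-> deducible delta w1 w2))).
Proof.
split; last first.
  split=> [k l a b|k l w1 w2 ww1 ww2]; first exact: eval_relation.
  by split; [exact: deducible_of_eval | exact: eval_ded].
split; first by move=> k l D; exact: word_of_diagram.
split; split; try (apply: val_inj; apply: imset_setT_bij).
- exact: mirror_node_bij.
- exact: dsharp_diagX.
- exact: mirror_node_bij.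
- exact: mirror_node_bij.
- exact: flip_node_bij.
- exact: dstar_diagX.
- exact: flip_node_bij.
- exact: flip_node_bij.
Qed.
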